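(* Let $T_i$ ($i=1,2,\dots$) and $T$ be normal integer rectifiable $n$-currents in $\mathbb{R}^N$ for which the mass and the mass of the boundary are compactly supported. Assume that $T_i\rightharpoonup T$ weakly and $\|T_i\|(\mathbb{R}^N)\to\|T\|(\mathbb{R}^N)$. Additionally, assume that for every $\epsilon>0$, for all sufficiently large $i$, $\mathrm{set}(\partial T_i)\subset(\mathrm{set}(\partial T))_\epsilon$. Then for every $k\in\{1,2,\dots\}$, $$\limsup_{i\to\infty}\hat\lambda_k(T_i)\le\hat\lambda_k(T),$$ where, for such a current $S$, $$\hat\lambda_k(S)=\inf_{\Lambda^k\subset C_c^\infty(\mathbb{R}^N\setminus\mathrm{set}(\partial S))}\ \sup_{f\in\Lambda^k\setminus\{0\}}\frac{\int|\nabla f|^2\,d\|S\|}{\int|f|^2\,d\|S\|},$$ the infimum being over all $k$-dimensional linear subspaces $\Lambda^k$ of $C_c^\infty(\mathbb{R}^N\setminus\mathrm{set}(\partial S))$.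
   Context: Here $n\le N$. An $n$-current on $\mathbb{R}^N$ is a continuous linear functional $T$ on the space $\mathcal{D}_n$ of smooth, compactly supported differential $n$-forms on $\mathbb{R}^N$. Weak convergence $T_i\rightharpoonup T$ means $T_i(\phi)\to T(\phi)$ for all $\phi\in\mathcal{D}_n$. The boundary of $T$ is the $(n-1)$-current $\partial T(\omega)=T(d\omega)$. For open $O\subset\mathbb{R}^N$, $\|T\|(O)=\sup\{T(\phi) : \phi\in\mathcal{D}_n,\ \|\phi\|\le 1,\ \mathrm{supp}(\phi)\subset O\}$, where the condition $\|\phi\|\le1$ means that at every point the comass $\|\phi\|=\sup\{\langle\xi,\phi\rangle : \xi \text{ a simple } n\text{-vector},\ |\xi|\le 1\}$ is at most $1$. $T$ has finite mass if $\|T\|(\mathbb{R}^N)<\infty$; then $\|T\|$ extends to a Radon measure on $\mathbb{R}^N$, also denoted $\|T\|$ and called the mass of $T$. $T$ is normal if both $T$ and $\partial T$ have finite mass. $T$ is integer rectifiable if $\|T\|$ is supported on a countably $n$-rectifiable set $A$ and $T(\phi)=\int_A\langle\phi,\xi\rangle\,\theta\,dH^n$ for all $\phi\in\mathcal{D}_n$, where $\xi(x)$ is a simple unit $n$-vector and $\theta$ is a positive function that is integer-valued $H^n$-almost everywhere. For an $m$-current $S$ of finite mass, $\mathrm{set}(S)$ is the set of $x\in\mathbb{R}^N$ with $\liminf_{r\to0}\|S\|(B(x,r))/r^m>0$ (so $m=n-1$ for $S=\partial T$). For $A\subset\mathbb{R}^N$, $A_\epsilon=\{x : d(x,A)<\epsilon\}$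 (empty if $A$ is empty). $C_c^\infty(\mathbb{R}^N\setminus\mathrm{set}(\partial S))$ is the space of smooth functions on $\mathbb{R}^N$ whose support is a compact subset of $\mathbb{R}^N\setminus\mathrm{set}(\partial S)$. $\nabla f$ is the Euclidean gradient. By convention the quotient $\int|\nabla f|^2\,d\|S\|\,/\int|f|^2\,d\|S\|$ equals $\infty$ when $f=0$ $\|S\|$-almost everywhere, and an infimum over an empty family is $\infty$. *)

(* Defs.v *)
From mathcomp Require Import all_boot all_order all_algebra.
From mathcomp Require Import all_classical all_reals all_analysis.

Set Implicit Arguments.
Unset Strict Implicit.
Unset Printing Implicit Defensive.

Import Order.TTheory GRing.Theory Num.Theory.
Import numFieldNormedType.Exports.

Local Open Scope classical_set_scope.
Local Open Scope ring_scope.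

(* R^N is 'rV[R]_N.  Its library norm is the sup norm: it is only used through
   the topology and the derivatives it induces, which are the Euclidean ones.
   All metric notions below use the Euclidean norm enorm. *)

Section Euclidean.
Context {R : realType} {N : nat}.
Implicit Types (x : 'rV[R]_N) (A : set 'rV[R]_N) (f : 'rV[R]_N -> R).

Definition enorm x : R := Num.sqrt (\sum_(i < N) x 0 i ^+ 2).

Definition eball x (r : R) : set 'rV[R]_N := [set y | enorm (y - x) < r].

(* +oo when A is empty *)
Definition edist x A : \bar R := ereal_inf [set (enorm (x - a))%:E | a in A].

Definition nbhd A (e : R) : set 'rV[R]_N := [set x | (edist x A < e%:E)%E].

Definition partial (i : 'I_N) f : 'rV[R]_N -> R := 'D_(delta_mx 0 i) f.

Definition partials (s : seq 'I_N) f : 'rV[R]_N -> R := foldr partial f s.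

Definition grad f x : 'rV[R]_N := \row_i partial i f x.

Definition smooth f : Prop := forall s x, differentiable (partials s f) x.

Definition supp f : set 'rV[R]_N := closure [set x | f x != 0].

Definition Cc_infty A : set ('rV[R]_N -> R) :=
  [set f | [/\ smooth f, compact (supp f) & supp f `<=` A]].

End Euclidean.

Section Forms.
Context {R : realType} {N : nat}.

(* A matrix V with n rows v_1, ..., v_n stands for the n-vector
   v_1 /\ ... /\ v_n, and an n-covector is an alternating multilinear function
   of v_1, ..., v_n. *)
Definition is_covector {n} (a : 'M[R]_(n, N) -> R) : Prop :=
  (forall (i : 'I_n) (A B C : 'M[R]_(n, N)) (b c : R),
     row i A = b *: row i B + c *: row i C ->
     row' i B = row' i A -> row' i C = row' i A ->
     a A = b * a B + c * a C) /\
  (forall (A : 'M[R]_(n, N)) (i j : 'I_n),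
     i != j -> row i A = row j A -> a A = 0).

(* The pair (c, V) stands for the simple n-vector c v_1 /\ ... /\ v_n; the
   scalar c is redundant except for n = 0, where the 0-vectors are the reals.
   |v_1 /\ ... /\ v_n|^2 is the Gram determinant. *)
Definition simple_vector (n : nat) : Type := (R * 'M[R]_(n, N))%type.

Definition vnorm {n} (xi : simple_vector n) : R :=
  `|xi.1| * Num.sqrt (\det (xi.2 *m xi.2^T)).

Definition pairing {n} (xi : simple_vector n) (a : 'M[R]_(n, N) -> R) : R :=
  xi.1 * a xi.2.

Definition comass {n} (a : 'M[R]_(n, N) -> R) : \bar R :=
  ereal_sup [set (pairing xi a)%:E | xi in [set xi | vnorm xi <= 1]].

Definition form (n : nat) : Type := 'rV[R]_N -> 'M[R]_(n, N) -> R.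

Definition fsupp {n} (phi : form n) : set 'rV[R]_N :=
  closure [set x | exists V, phi x V != 0].

Definition test_form {n} : set (form n) :=
  [set phi | [/\ forall x, is_covector (phi x),
                 forall V, smooth (fun x => phi x V) &
                 compact (fsupp phi)]].

(* d omega (v_0, ..., v_m) =
     \sum_i (-1)^i D_(v_i) omega (v_0, ..., v_(i-1), v_(i+1), ..., v_m) *)
Definition extd {n} (omega : form n.-1) : form n := fun x V =>
  \sum_(i < n) (-1) ^+ i * 'D_(row i V) (fun y => omega y (row' i V)) x.

(* rowsub f 1%:M has rows e_(f 0), ..., e_(f (n-1)), so this compares the
   partial derivatives up to order m of the coefficients of the two forms. *)
Definition form_close {n} (m : nat) (e : R) (phi psi : form n) : Prop :=
  forall (s : seq 'I_N) (f : 'I_n -> 'I_N) (x : 'rV[R]_N), (size s <= m)%N ->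
    `|partials s (fun y => psi y (rowsub f 1%:M) - phi y (rowsub f 1%:M)) x|
      < e.

Definition test_form_in {n} (K : set 'rV[R]_N) : set (form n) :=
  [set phi | test_form phi /\ fsupp phi `<=` K].

(* The finest topology on the space of test forms for which the inclusions of
   the spaces test_form_in K, K compact, are continuous, test_form_in K having
   the topology of uniform convergence of all derivatives. *)
Definition open_test_forms {n} (U : set (form n)) : Prop :=
  forall K, compact K -> forall phi, test_form_in K phi -> U phi ->
    exists (m : nat) (e : R), 0 < e /\
      forall psi, test_form_in K psi -> form_close m e phi psi -> U psi.

End Forms.

Arguments form : clear implicits.
Arguments simple_vector : clear implicits.

Section Currents.
Context {R : realType} {N : nat}.

(* Only the values on test forms are relevant. *)
Definition functional (n : nat) : Type := form R N n -> R.

Definition is_current {n} (T : functional n) : Prop :=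
  (forall (a : R) (phi psi : form R N n), test_form phi -> test_form psi ->
     T (fun x V => a * phi x V + psi x V) = a * T phi + T psi) /\
  (forall O : set R, open O -> open_test_forms (T @^-1` O)).

Definition bdry {n} (T : functional n) : functional n.-1 :=
  fun omega => T (extd omega).

Definition weak_cvg {n} (T_ : nat -> functional n) (T : functional n) : Prop :=
  forall phi, test_form phi -> (fun i => T_ i phi) @ \oo --> T phi.

Definition mass_open {n} (T : functional n) (O : set 'rV[R]_N) : \bar R :=
  ereal_sup [set (T phi)%:E | phi in
    [set phi | [/\ test_form phi, forall x, (comass (phi x) <= 1)%E &
                   fsupp phi `<=` O]]].

Definition finite_mass {n} (T : functional n) : Prop :=
  (mass_open T setT < +oo)%E.

(* The mass measure: when T has finite mass, the unique extension of
   mass_open T to a Radon measure is outer regular. *)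
Definition mass {n} (T : functional n) (A : set 'rV[R]_N) : \bar R :=
  ereal_inf [set mass_open T O | O in [set O | open O /\ A `<=` O]].

Definition normal_current {n} (T : functional n) : Prop :=
  [/\ is_current T, finite_mass T & finite_mass (bdry T)].

Definition measure_supp (mu : set 'rV[R]_N -> \bar R) : set 'rV[R]_N :=
  [set x | forall O, open O -> O x -> (0 < mu O)%E].

Definition density_set {n} (S : functional n) : set 'rV[R]_N :=
  [set x | (0 < limf_einf (fun r : R => mass S (eball x r) / (r ^+ n)%:E)
                          (0 : R)^'+)%E].

End Currents.

Arguments functional : clear implicits.

Section Rectifiable.
Context {R : realType}.

(* volume of the unit ball of R^m *)
Fixpoint ball_volume (m : nat) : R :=
  match m with
  | 0 => 1
  | 1 => 2
  | m'.+2 => 2 * pi / m'.+2%:R * ball_volume m'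
  end.

Context {N : nat}.

Definition diam (C : set 'rV[R]_N) : \bar R :=
  ereal_sup [set (enorm (p.1 - p.2))%:E | p in C `*` C].

Definition hausdorff_weight (m : nat) (C : set 'rV[R]_N) : \bar R :=
  if C == set0 then 0%E
  else ((ball_volume m)%:E * (diam C * (2^-1)%:E) ^+ m)%E.

Definition hausdorff_delta (m : nat) (delta : R) (A : set 'rV[R]_N) : \bar R :=
  ereal_inf [set (\sum_(0 <= j <oo) hausdorff_weight m (C j))%E | C in
    [set C : nat -> set 'rV[R]_N |
      A `<=` \bigcup_j C j /\ forall j, (diam (C j) <= delta%:E)%E]].

Definition hausdorff (m : nat) (A : set 'rV[R]_N) : \bar R :=
  ereal_sup [set hausdorff_delta m delta A | delta in [set d : R | 0 < d]].

(* R^N with the sigma-algebra of (Caratheodory) H^m-measurable sets *)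
Definition hausdorff_space (m : nat) :=
  g_sigma_algebraType (caratheodory_measurable (hausdorff m)).

Definition countably_rectifiable (m : nat) (A : set 'rV[R]_N) : Prop :=
  caratheodory_measurable (hausdorff m) A /\
  exists F : nat -> 'rV[R]_m -> 'rV[R]_N,
    (forall j, exists L : R,
       forall x y, enorm (F j x - F j y) <= L * enorm (x - y)) /\
    hausdorff m (A `\` \bigcup_j range (F j)) = 0%E.

(* If theta were not locally H^n-integrable on A, the integral below would be
   infinite for some phi; integrability is thus part of the last condition. *)
Definition integer_rectifiable {n} (T : functional R N n) : Prop :=
  exists (A : set 'rV[R]_N) (xi : 'rV[R]_N -> simple_vector R N n)
         (theta : 'rV[R]_N -> R),
    [/\ countably_rectifiable n A /\ mass T (~` A) = 0%E,
        (forall a, is_covector a -> measurable_fun (T := hausdorff_space n) A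
           (fun x => pairing (xi x) a)) /\
        (forall x, A x -> vnorm (xi x) = 1),
        measurable_fun (T := hausdorff_space n) A theta /\
        (forall x, A x -> 0 < theta x),
        hausdorff n [set x | A x /\ ~ (theta x \is a Num.int)] = 0%E &
        forall phi, test_form phi ->
          (T phi)%:E =
          (\int[hausdorff n : set (hausdorff_space n) -> _]_(x in A)
             (pairing (xi x) (phi x) * theta x)%:E)%E].

End Rectifiable.

Section Eigenvalues.
Context {R : realType} {N : nat}.

Definition borel_space := g_sigma_algebraType (@open 'rV[R]_N).

Definition rayleigh {n} (S : functional R N n) (f : 'rV[R]_N -> R) : \bar R :=
  if `[< negligible (mass S : set borel_space -> \bar R)
                    [set x | f x != 0] >] then +oo%E
  else (\int[mass S : set borel_space -> \bar R]_x (enorm (grad f x) ^+ 2)%:E /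
        \int[mass S : set borel_space -> \bar R]_x (`|f x| ^+ 2)%:E)%E.

Definition subspace_of_dim (k : nat) (L : set ('rV[R]_N -> R)) : Prop :=
  exists b : 'I_k -> 'rV[R]_N -> R,
    (forall c : 'I_k -> R,
       (forall x, \sum_i c i * b i x = 0) -> forall i, c i = 0) /\
    L = [set f | exists c : 'I_k -> R, f = fun x => \sum_i c i * b i x].

Definition lambda_hat {n} (k : nat) (S : functional R N n) : \bar R :=
  ereal_inf
    [set ereal_sup [set rayleigh S f | f in L `\ cst 0] | L in
      [set L | subspace_of_dim k L /\
               L `<=` Cc_infty (~` density_set (bdry S))]].

End Eigenvalues.

(* Main.v *)
(* The statement reduces to convergence of the Gram matrices of finitely many
   functions.  Mass is lower semicontinuous on open sets under weak convergence
   of currents; together with convergence of the total mass this gives weak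
   convergence of the measures ||T_i|| to ||T||.  Let b_1, ..., b_k span a
   nearly optimal space for T.  Since set(dT) need not be closed, supp b_p may
   touch its closure, and b_p need not be a test function for T_i.  However the
   b_p vanish on set(dT), hence so does g = \sum_p b_p^2; multiplying the b_p by
   a cutoff chi_m = step((m+1) g - 1) yields functions supported at positive
   distance from set(dT), admissible for T_i when i is large.  The gradient of
   chi_m b_p stays bounded, because |b_p| |b_q| <= g is O(1/m) where chi_m
   varies, and converges pointwise to 1_{g != 0} grad b_p, so dominated
   convergence shows that the energies do not increase in the limit.  A
   perturbation argument for quadratic forms on R^k concludes. *)
From HB Require Import structures.
Require Import Defs.
From mathcomp Require Import all_boot all_order all_algebra.
From mathcomp Require Import all_classical all_reals all_analysis.
From mathcomp Require Import measurable_realfun ring lra.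

Import Order.TTheory GRing.Theory Num.Theory.
Import numFieldNormedType.Exports.

Local Open Scope classical_set_scope.
Local Open Scope ring_scope.

(** * Smooth functions and cutoffs *)

Section SmoothFunctions.
Context {R : realType} {N : nat}.
Implicit Types (f g : 'rV[R]_N -> R) (x : 'rV[R]_N).

(* Continuous differentiability to order m, with the order of the partial
   derivatives reversed with respect to [partials]; this allows induction on m. *)
Fixpoint Ck (m : nat) f : Prop :=
  (forall x, differentiable f x) /\
  match m with 0 => True | m'.+1 => forall i, Ck m' (partial i f) end.

Lemma partials_rcons s i f : partials (rcons s i) f = partials s (partial i f).
Proof. by rewrite /partials foldr_rcons. Qed.

Lemma smoothE f : smooth f <-> forall m, Ck m f.
Proof.
split.
- move=> fs m; elim: m f fs => [|m ih] f fs /=; first by split=> // x; exact: (fs [::]).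
  split=> [x|i]; first exact: (fs [::]).
  by apply: ih => s x; rewrite -partials_rcons.
- move=> fC s; elim/last_ind: s f fC => [|s i ih] f fC x; first by case: (fC 0%N).
  rewrite partials_rcons; apply: ih => m.
  by case: (fC m.+1) => _ /(_ i).
Qed.

Lemma CkS m f : Ck m.+1 f -> Ck m f.
Proof.
elim: m f => [|m ih] f [df /= pf]; split=> // i; exact: ih.
Qed.

Lemma partial_cst i (c : R) : partial i (cst c : 'rV[R]_N -> R) = cst 0.
Proof. by apply/funext => x; rewrite /partial derive_cst. Qed.

Lemma partialD i f g : (forall x, differentiable f x) ->
  (forall x, differentiable g x) ->
  partial i (f \+ g) = partial i f \+ partial i g.
Proof.
move=> df dg; apply/funext => x; rewrite /partial.
by apply: deriveD; exact: diff_derivable.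
Qed.

Lemma partialM i f g : (forall x, differentiable f x) ->
  (forall x, differentiable g x) ->
  partial i (f \* g) = (f \* partial i g) \+ (g \* partial i f).
Proof.
move=> df dg; apply/funext => x; rewrite /partial.
by apply: deriveM; exact: diff_derivable.
Qed.

Lemma partial_comp i (h h' : R -> R) f : (forall t : R, is_derive t 1 h (h' t)) ->
  (forall x, differentiable f x) ->
  partial i (h \o f) = (h' \o f) \* partial i f.
Proof.
move=> dh df; apply/funext => x; rewrite /partial /=.
have dhx : differentiable h (f x) by apply/derivable1_diffP; case: (dh (f x)).
rewrite deriveE; last exact: differentiable_comp.
rewrite diff_comp//= (diff1E dhx) -deriveE// derive1E.
by case: (dh (f x)) => _ ->; rewrite mulrC.
Qed.

Lemma Ck_cst m (c : R) : Ck m (cst c).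
Proof.
elim: m c => [|m ih] c; split=> //; try by move=> x; exact: differentiable_cst.
by move=> i; rewrite partial_cst.
Qed.

Lemma CkD m f g : Ck m f -> Ck m g -> Ck m (f \+ g).
Proof.
elim: m f g => [|m ih] f g [df /= pf] [dg /= pg]; split=> //;
  try by move=> x; exact: (differentiableD (df x) (dg x)).
by move=> i; rewrite partialD//; exact: (ih _ _ (pf i) (pg i)).
Qed.

Lemma CkM m f g : Ck m f -> Ck m g -> Ck m (f \* g).
Proof.
elim: m f g => [|m ih] f g fm gm; move: (fm) (gm) => [df /= pf] [dg /= pg]; split=> //;
  try by move=> x; exact: (differentiableM (df x) (dg x)).
(* The Leibniz rule leaves one factor undifferentiated in each term; [CkS] lowers that factor to
   order [m]. *)
move=> i; rewrite partialM//.
by apply: CkD; apply: ih; by [exact: CkS | exact: pf | exact: pg].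
Qed.

Lemma smooth_cst (c : R) : smooth (cst c : 'rV[R]_N -> R).
Proof. by apply/smoothE => m; exact: Ck_cst. Qed.

Lemma smoothD f g : smooth f -> smooth g -> smooth (fun x => f x + g x).
Proof. by move=> /smoothE fs /smoothE gs; apply/smoothE => m; exact: CkD. Qed.

Lemma smoothM f g : smooth f -> smooth g -> smooth (fun x => f x * g x).
Proof. by move=> /smoothE fs /smoothE gs; apply/smoothE => m; exact: CkM. Qed.

Lemma smoothZ (c : R) f : smooth f -> smooth (fun x => c * f x).
Proof. by apply: smoothM; exact: smooth_cst. Qed.

Lemma smooth_sum I (r : seq I) (P : pred I) (F : I -> 'rV[R]_N -> R) :
  (forall i, smooth (F i)) -> smooth (fun x => \sum_(i <- r | P i) F i x).
Proof.
move=> Fs; elim: r => [|i r ih].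
  by under eq_fun do rewrite big_nil; exact: smooth_cst.
under eq_fun do rewrite big_cons; case: (P i) => //.
exact: smoothD.
Qed.

Lemma smooth_coord j : smooth (fun x : 'rV[R]_N => x 0 j).
Proof.
apply/smoothE => m; case: m => [|m]; split=> //;
  try by move=> x; exact: differentiable_coord.
move=> i; suff -> : partial i (fun x => x 0 j) = cst ((delta_mx 0 i : 'rV[R]_N) 0 j).
  exact: Ck_cst.
apply/funext => x; rewrite /partial deriveE; last exact: differentiable_coord.
(* The coordinate is packaged as a continuous linear map, which is its own differential. *)
have [L] : exists2 l : {linear 'rV[R]_N -> R},
    (l : _ -> _) = (fun y : 'rV[R]_N => y 0 j) & continuous l.
  have lin : linear (fun y : 'rV[R]_N => y 0 j : R^o) by move=> a u v; rewrite !mxE.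
  pose L : {linear 'rV[R]_N -> R^o} :=
    HB.pack (fun y : 'rV[R]_N => y 0 j : R^o)
      (GRing.isLinear.Build R _ _ _ _ lin).
  by exists L => //; exact: coord_continuous.
by move=> le cl; rewrite -le diff_lin// le.
Qed.

Lemma smooth_diff f : smooth f -> forall x, differentiable f x.
Proof. by move=> fs; exact: (fs [::]). Qed.

Lemma smooth_cont f : smooth f -> continuous f.
Proof. by move=> fs x; exact/differentiable_continuous/smooth_diff. Qed.

Lemma smooth_partial i f : smooth f -> smooth (partial i f).
Proof. by move=> fs s x; rewrite -partials_rcons. Qed.

End SmoothFunctions.

(** * A smooth step function on the line *)

Section SmoothStep.
Context {R : realType}.

(* The span of these functions is closed under differentiation. *)
Definition bumpj (j : nat) (t : R) : R := if 0 < t then t ^- j * expR (- t^-1) else 0.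

(** For [m > 0], exp(s) = exp(s/m)^m >= (1 + s/m)^m >= (s/m)^m. Taken at s = 1/t, this shows that
    exp(-1/t) beats every negative power of t near 0. *)
Lemma expR_ge_pow (m : nat) (s : R) : 0 <= s -> s ^+ m <= m%:R ^+ m * expR s.
Proof.
case: m => [|m] s0; first by rewrite !expr0 mul1r (le_trans _ (expR_ge1Dx _))// lerDl.
have m0 : (0 : R) < m.+1%:R by [].
rewrite -[in expR s](@mulfVK _ m.+1%:R _ s)// ?lt0r_neq0//.
rewrite -[s / _ * _]mulrC expRM_natl -exprMn.
rewrite lerXn2r// ?nnegrE ?mulr_ge0// ?expR_ge0//.
rewrite -ler_pdivrMl// mulrC.
by rewrite (le_trans _ (expR_ge1Dx _))// lerDr.
Qed.

(** Write t^-j = t^2 (1/t)^(j+2) and absorb the second factor by [expR_ge_pow] at 1/t. Quadratic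
    decay is what makes the derivative at the origin vanish. *)
Lemma bumpj_le j : exists2 C : R, 0 <= C & forall t, `|bumpj j t| <= C * t ^+ 2.
Proof.
exists (j.+2%:R ^+ j.+2); first exact: exprn_ge0.
move=> t; rewrite /bumpj; case: ifPn => t0;
  last by rewrite normr0 mulr_ge0 ?sqr_ge0 ?exprn_ge0.
rewrite ger0_norm; last by rewrite mulr_ge0 ?expR_ge0// invr_ge0 exprn_ge0// ltW.
have := expR_ge_pow j.+2 t^-1 _; rewrite invr_ge0 ltW// => /(_ isT) h.
have -> : t ^- j = t ^+ 2 * t^-1 ^+ j.+2.
  rewrite exprVn (exprS _ j.+1) (exprS _ j).
  have : t ^+ j != 0 by rewrite expf_neq0// lt0r_neq0.
  by move: (t ^+ j) => u u0; field; rewrite u0 lt0r_neq0.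
rewrite expRN ler_pdivrMr ?expR_gt0//.
by apply: le_trans (ler_wpM2l (sqr_ge0 t) h) _; rewrite mulrCA mulrA.
Qed.

(** Away from 0 this is calculus on either side; at 0 the difference quotient is at most C |h| by
    [bumpj_le]. For [j = 0] the second term drops out, so the derivative of [bumpj 0] is
    [bumpj 2]. *)
Lemma bumpj_derive j (t : R) :
  is_derive t 1 (bumpj j) (bumpj j.+2 t - j%:R * bumpj j.+1 t).
Proof.
have [t0|t0|->] := ltgtP t 0.
- rewrite /bumpj !ltNge (ltW t0)/= mulr0 subr0.
  have : is_derive t 1 (cst 0 : R -> R) 0 by exact: is_derive_cst.
  apply: near_eq_is_derive.
  near=> s; have : s < 0 by near: s; exact: lt_nbhsl.
  by move=> s0; rewrite ltNge (ltW s0).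
- have tn0 : t != 0 by rewrite gt_eqF.
  have H : is_derive t 1 (fun s => s ^- j * expR (- s^-1))
      (bumpj j.+2 t - j%:R * bumpj j.+1 t).
    rewrite /bumpj t0.
    have tj0 : t ^+ j != 0 by rewrite expf_neq0.
    have dV : is_derive t 1 (fun s : R => s^-1) (- t ^- 2 *: 1).
      exact: (@is_deriveV R id t 1 1 tn0 (is_derive_id t 1)).
    have dj : is_derive t 1 (fun s : R => s ^- j) (- j%:R * t ^- j.+1).
      have dX := derivableP (@exprn_derivable R j t 1).
      rewrite exp_derive in dX.
      apply: (is_derive_eq (@is_deriveV R (fun s => s ^+ j) t _ 1 tj0 dX)).
      case: (j) tj0 => [|i] ti0; first by rewrite !(scale0r, scaler0) oppr0 mul0r.
      rewrite /= /GRing.scale/= mulr1 !exprS.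
      move: ti0; rewrite exprS mulf_eq0 negb_or => /andP[_].
      by move: (t ^+ i) => u u0; field; rewrite tn0 u0.
    have de : is_derive t 1 (expR \o (fun s : R => - s^-1))
        (expR (- t^-1) * - (- t ^- 2 *: 1)).
      exact: is_derive1_comp.
    apply: (is_derive_eq (is_deriveM dj de)).
    rewrite /GRing.scale/= !exprS; move: (t ^+ j) tj0 (expR _) => u u0 E.
    by field; rewrite tn0 u0.
  apply: near_eq_is_derive _ H.
  near=> s; have : 0 < s by near: s; exact: lt_nbhsr.
  by rewrite /bumpj => ->.
- rewrite /bumpj ltxx mulr0 subr0.
  have [C C0 HC] := bumpj_le j.
  have cv : (fun h : R => h^-1 *: (bumpj j (h *: 1 + 0) - bumpj j 0)) @ 0^' --> (0 : R).
    apply/cvgrPdist_lt => e e0; near=> h.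
    have hn0 : h != 0 by near: h; exact: nbhs_dnbhs_neq.
    rewrite sub0r normrN addr0 [h *: 1]mulr1 [bumpj j 0]/bumpj ltxx subr0 normrZ.
    rewrite (le_lt_trans (ler_wpM2l (normr_ge0 _) (HC h)))//.
    rewrite normfV -real_normK ?num_real// expr2 mulrCA mulKf ?normr_eq0//.
    (* Dividing by [C + 1] avoids the possible value [C = 0]. *)
    have hd : `|h| < e / (C + 1).
      by near: h; apply: dnbhs0_lt; rewrite divr_gt0// ltr_wpDl.
    rewrite (@le_lt_trans _ _ ((C + 1) * `|h|))//; first by rewrite ler_wpM2r// lerDl.
    by rewrite mulrC -ltr_pdivlMr// ltr_wpDl.
  by apply: DeriveDef; [apply: (cvgP _ cv)|exact: (cvg_lim _ cv)].
Unshelve. all: by end_near.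
Qed.

Lemma bumpj_npos j (t : R) : t <= 0 -> bumpj j t = 0.
Proof. by move=> t0; rewrite /bumpj ltNge t0. Qed.

Lemma bumpj_ge0 j (t : R) : 0 <= bumpj j t.
Proof.
by rewrite /bumpj; case: ifPn => // t0;
  rewrite mulr_ge0 ?expR_ge0// invr_ge0 exprn_ge0// ltW.
Qed.

Lemma bumpj_gt0 j (t : R) : 0 < t -> 0 < bumpj j t.
Proof. by move=> t0; rewrite /bumpj t0 mulr_gt0 ?expR_gt0// invr_gt0 exprn_gt0. Qed.

Lemma bump0_homo (s t : R) : s <= t -> bumpj 0 s <= bumpj 0 t.
Proof.
move=> st; have [s0|s0] := leP s 0; first by rewrite bumpj_npos// bumpj_ge0.
have t0 := lt_le_trans s0 st.
by rewrite /bumpj s0 t0 !expr0 invr1 !mul1r ler_expR lerN2 lef_pV2.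
Qed.

(** On (0, 1] the quadratic bound gives [C]; beyond 1 both t^-j and exp(-1/t) are at most 1. *)
Lemma bumpj_bounded j : exists B : R, forall t : R, `|bumpj j t| <= B.
Proof.
have [C C0 HC] := bumpj_le j.
exists (Num.max C 1) => t; rewrite le_max.
have [t0|t0] := leP t 0; first by rewrite bumpj_npos// normr0 C0.
have [t1|t1] := leP t 1; apply/orP; [left|right].
  by rewrite (le_trans (HC t))// ler_piMr// expr_le1// ltW.
rewrite ger0_norm ?bumpj_ge0// /bumpj t0 mulr_ile1 ?expR_ge0//.
- by rewrite invr_ge0 exprn_ge0// ltW.
- by rewrite invf_le1 ?exprn_gt0// exprn_ege1// ltW.
- by rewrite -expR0 ler_expR oppr_le0 invr_ge0 ltW.
Qed.

(* The inner bump vanishes for t <= 0 and is at least its value at 1 for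
   t >= 1; this makes the step a composition of bumps, without any division
   of functions. *)
Definition step (t : R) : R :=
  1 - (bumpj 0 (bumpj 0 1))^-1 * bumpj 0 (bumpj 0 1 - bumpj 0 t).

(** The derivative of [step] by the chain rule, [bumpj 2] being the derivative of [bumpj 0]; the two
    minus signs cancel. *)
Definition dstep (t : R) : R :=
  (bumpj 0 (bumpj 0 1))^-1 * (bumpj 2 (bumpj 0 1 - bumpj 0 t) * bumpj 2 t).

Let bb_gt0 : 0 < bumpj 0 (bumpj 0 1) :> R.
Proof. by rewrite !bumpj_gt0. Qed.

Lemma step_le0 t : t <= 0 -> step t = 0.
Proof.
by move=> t0; rewrite /step (bumpj_npos 0 t t0) subr0 mulVf ?subrr// gt_eqF.
Qed.

Lemma step_ge1 t : 1 <= t -> step t = 1.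
Proof.
by move=> t1; rewrite /step (bumpj_npos 0 (_ - _)) ?mulr0 ?subr0// subr_le0 bump0_homo.
Qed.

Lemma step_ge0 t : 0 <= step t.
Proof.
by rewrite subr_ge0 mulrC ler_pdivrMr// mul1r bump0_homo// gerBl bumpj_ge0.
Qed.

Lemma step_le1 t : step t <= 1.
Proof. by rewrite gerBl mulr_ge0 ?bumpj_ge0// invr_ge0 ltW. Qed.

Lemma dstep_le0 t : t <= 0 -> dstep t = 0.
Proof. by move=> t0; rewrite /dstep (bumpj_npos 2 t t0) !mulr0. Qed.

Lemma dstep_ge1 t : 1 <= t -> dstep t = 0.
Proof.
move=> t1; rewrite /dstep (bumpj_npos 2 (_ - _)) ?mul0r ?mulr0//.
by rewrite subr_le0 bump0_homo.
Qed.

Lemma dstep_bounded : exists2 B : R, 0 <= B & forall t : R, `|dstep t| <= B.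
Proof.
have [B HB] := bumpj_bounded 2.
have B0 : 0 <= B by exact: le_trans (HB 0).
exists ((bumpj 0 (bumpj 0 1))^-1 * (B * B)).
  by rewrite !mulr_ge0// invr_ge0 ltW.
move=> t; rewrite !normrM gtr0_norm ?invr_gt0//.
by rewrite ler_wpM2l ?invr_ge0 ?(ltW bb_gt0)// ler_pM.
Qed.

Lemma step_derive (t : R) : is_derive t 1 step (dstep t).
Proof.
have d1 := bumpj_derive 0 t; rewrite mul0r subr0 in d1.
have d2 := bumpj_derive 0 (bumpj 0 1 - bumpj 0 t); rewrite mul0r subr0 in d2.
have d3 : is_derive t 1 (fun s : R => bumpj 0 1 - bumpj 0 s) (0 - bumpj 2 t).
  exact: is_deriveB.
have d4 := @is_derive1_comp R (bumpj 0) (fun s => bumpj 0 1 - bumpj 0 s) t _ _ d2 d3.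
have d0 : is_derive t 1 (cst 1 : R -> R) 0 by exact: is_derive_cst.
have d5 := is_deriveB d0 (is_deriveZ (bumpj 0 (bumpj 0 1))^-1 d4).
by apply: (is_derive_eq d5); rewrite /dstep /GRing.scale/= !sub0r mulrN mulrN opprK.
Qed.

End SmoothStep.

(** * Smooth cutoffs and a smooth Urysohn lemma *)

Section SmoothCutoff.
Context {R : realType} {N : nat}.
Implicit Types (f g : 'rV[R]_N -> R) (x : 'rV[R]_N).

(** Differentiating replaces [j] by [j + 1] and [j + 2], so the induction on [m] must treat all [j]
    at once. *)
Lemma Ck_bumpj m f : Ck m f -> forall j, Ck m (bumpj j \o f).
Proof.
elim: m f => [|m ih] f fm j; move: (fm) => [df /= pf].
  split => // x; apply: differentiable_comp => //.
  by apply/derivable1_diffP; case: (bumpj_derive j (f x)).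
split; first by move=> x; apply: differentiable_comp => //;
  apply/derivable1_diffP; case: (bumpj_derive j (f x)).
move=> i; rewrite (partial_comp i _ _ _ (bumpj_derive j))//.
apply: CkM; last exact: pf.
have fm' := CkS _ _ fm.
rewrite (_ : _ \o _ = (bumpj j.+2 \o f) \+ (cst (- j%:R) \* (bumpj j.+1 \o f))).
  by apply: CkD; [exact: ih|apply: CkM; [exact: Ck_cst|exact: ih]].
by apply/funext => x /=; rewrite mulNr.
Qed.

Lemma smooth_bump f : smooth f -> smooth (fun x => bumpj 0 (f x)).
Proof. by move=> /smoothE fs; apply/smoothE => m; exact: Ck_bumpj. Qed.

Lemma smooth_step f : smooth f -> smooth (fun x => step (f x)).
Proof.
move=> fs; apply: smoothD; first exact: smooth_cst.
rewrite (_ : (fun _ => _) = (fun x =>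
  - (bumpj 0 (bumpj 0 1))^-1 * bumpj 0 (bumpj 0 1 + (-1) * bumpj 0 (f x)))).
  apply: smoothZ; apply: smooth_bump; apply: smoothD; first exact: smooth_cst.
  by apply: smoothZ; exact: smooth_bump.
by apply/funext => x; rewrite mulN1r mulNr.
Qed.

(** This is 0 where a g <= 1 and 1 where a g >= 2. The shift by 1 keeps even the closed support
    inside the set a g >= 1, away from the zeros of g. *)
Definition cutoff (a : R) g x : R := step (a * g x - 1).

Lemma smooth_cutoff a g : smooth g -> smooth (cutoff a g).
Proof.
move=> gs; apply: smooth_step; apply: smoothD; first exact: smoothZ.
exact: smooth_cst.
Qed.

Lemma cutoff_closure a g : continuous g ->
  closure [set x | cutoff a g x != 0] `<=` [set x | 1 <= a * g x].
Proof.
move=> cg; have cl : closed [set x | 1 <= a * g x].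
  apply: (@closed_comp _ _ (fun x => a * g x) [set t | 1 <= t]); last exact: closed_ge.
  by move=> x _; exact: (continuousM (@cst_continuous _ _ a x) (cg x)).
refine (subset_trans (closureS _) cl) => x /=.
by apply: contra_neqT; rewrite -ltNge => h; rewrite /cutoff step_le0// subr_le0 ltW.
Qed.

(** The function is a finite sum of bumps on balls inside [U] that cover [K]. *)
Lemma compact_smooth_pos (K U : set 'rV[R]_N) : compact K -> open U -> K `<=` U ->
  exists g, [/\ smooth g, forall x, 0 <= g x, forall x, g x != 0 -> U x &
    forall x, K x -> 0 < g x].
Proof.
move=> cK oU KU.
have /choice[r Hr] : forall p : 'rV[R]_N, exists r : R, 0 < r /\ (K p -> ball p r `<=` U).
  move=> p; have [/KU Up|nKp] := pselect (K p); last by exists 1; split.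
  by have /nbhs_ballP[r /= r0 rU] := oU p Up; exists r.
(* This is r_p^2 - |x - p|^2 with the Euclidean norm, written with sums and products only so that
   the smoothness lemmas apply. *)
pose d p x := r p ^+ 2 + \sum_(i < N) -1 * ((x 0 i + - p 0 i) * (x 0 i + - p 0 i)).
have ds p : smooth (d p).
  apply: smoothD; first exact: smooth_cst.
  apply: smooth_sum => i; apply: smoothZ.
  by apply: smoothM; apply: smoothD; (exact: smooth_coord || exact: smooth_cst).
(* [ball] refers to the sup norm, which the Euclidean norm dominates. *)
have dball p x : 0 < d p x -> ball p (r p) x.
  have [rp _] := Hr p.
  rewrite /d => h; split=> // i j; rewrite ord1 /ball/= distrC.
  rewrite -ltr_sqr ?nnegrE// ?(ltW rp)// real_normK ?num_real//.
  apply: le_lt_trans (_ : \sum_(i < N) (x 0 i - p 0 i) ^+ 2 < _).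
    by rewrite (bigD1 j)//= lerDl sumr_ge0// => k _; exact: sqr_ge0.
  rewrite -subr_gt0 -sumrN; apply: lt_le_trans h _; rewrite lerD2l.
  by apply: ler_sum => k _; rewrite mulN1r expr2.
have dpp p : 0 < d p p.
  have [rp _] := Hr p; rewrite /d big1 ?addr0 ?exprn_gt0// => i _.
  by rewrite subrr !mulr0.
move: cK; rewrite compact_cover => /(_ _ K (fun p => [set x | 0 < d p x])).
case.
- move=> p _; apply: (@open_comp _ _ (d p) [set t | 0 < t]); last exact: open_gt.
  by move=> x _; exact: smooth_cont.
- by move=> x Kx; exists x => //=.
move=> D DK KD; exists (fun x => \sum_(p <- finmap.enum_fset D) bumpj 0 (d p x)); split.
- by apply: smooth_sum => p; exact: smooth_bump.
- by move=> x; apply: sumr_ge0 => p _; exact: bumpj_ge0.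
- move=> x h; apply: contrapT => nUx; move/eqP: h; apply.
  rewrite big_seq big1// => p /DK; rewrite inE => Kp; apply: bumpj_npos.
  rewrite leNgt; apply/negP => /dball bx; exact/nUx/((Hr p).2 Kp).
- move=> x /KD[p /= pD dpx]; rewrite (big_rem p)//=.
  apply: ltr_pwDl; first exact: bumpj_gt0.
  by apply: sumr_ge0 => q _; exact: bumpj_ge0.
Qed.

Lemma compact_lt (K : set 'rV[R]_N) g : compact K -> continuous g ->
  (forall x, K x -> 0 < g x) -> exists2 a, 0 < a & forall x, K x -> 1 < a * g x.
Proof.
move=> cK cg gK; have [K0|/set0P K0] := eqVneq K set0.
  by exists 1 => // x; rewrite K0.
have [x0 Kx0 mx0] := compact_EVT_min K0 cK (continuous_subspaceT cg).
rewrite inE in Kx0; have g0 := gK _ Kx0.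
exists (2 / g x0); first by rewrite divr_gt0.
move=> x Kx; have := mx0 x; rewrite inE => /(_ Kx) h.
rewrite -mulrA mulrC; apply: lt_le_trans (_ : 1 < 2) _; first by rewrite ltr1n.
by rewrite ler_peMl// mulrC ler_pdivlMr// mul1r.
Qed.

(** Having chi = 1 on a neighbourhood [W] of [K], not just on [K], keeps the support of 1 - chi away
    from [K]; partitions of unity need this. *)
Lemma smooth_urysohn (K U : set 'rV[R]_N) : compact K -> open U -> K `<=` U ->
  exists chi : 'rV[R]_N -> R, [/\ smooth chi, forall x, 0 <= chi x <= 1,
    closure [set x | chi x != 0] `<=` U &
    exists W, [/\ open W, K `<=` W & forall x, W x -> chi x = 1]].
Proof.
move=> cK oU KU.
have [g [gs g0 gU gK]] := compact_smooth_pos K U cK oU KU.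
have [a a0 aK] := compact_lt K g cK (smooth_cont _ gs) gK.
(* Doubling [a] makes the argument 2 a g - 1 of [step] exceed 1 on the open set a g > 1, which
   serves as [W]. *)
exists (cutoff (2 * a) g); split.
- exact: smooth_cutoff.
- by move=> x; rewrite step_ge0 step_le1.
- refine (subset_trans (cutoff_closure _ _ _) _); first exact: smooth_cont.
  move=> x /= h; apply: gU; apply: contraTneq h => ->.
  by rewrite mulr0 -ltNge.
- exists [set x | 1 < a * g x]; split => //.
  + apply: (@open_comp _ _ (fun x => a * g x) [set t | 1 < t]); last exact: open_gt.
    by move=> x _; exact: (continuousM (@cst_continuous _ _ a x) (smooth_cont _ gs x)).
  + by move=> x /= h; apply: step_ge1; rewrite -mulrA; lra.
Qed.

End SmoothCutoff.

(** * The mass as a Borel measure *)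

Section MassMeasure.
Context {R : realType} {N n : nat}.
Implicit Types (phi psi : Defs.form R N n) (O U : set 'rV[R]_N).

Definition admissible O : set (Defs.form R N n) :=
  [set phi | [/\ test_form phi, forall x, (comass (phi x) <= 1)%E & fsupp phi `<=` O]].

Lemma comass_le1P (a : 'M[R]_(n, N) -> R) :
  (comass a <= 1)%E <-> forall xi, vnorm xi <= 1 -> pairing xi a <= 1.
Proof.
split=> [h xi xi1|h].
  by rewrite -lee_fin; apply: le_trans h; apply: ereal_sup_ubound; exists xi.
by apply: ge_ereal_sup => _ [xi xi1 <-]; rewrite lee_fin h.
Qed.

Lemma fsupp_mul (chi : 'rV[R]_N -> R) phi :
  fsupp (fun x V => chi x * phi x V) `<=` fsupp phi.
Proof.
by apply: closureS => x [V]; rewrite mulf_eq0 negb_or => /andP[_ ?]; exists V.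
Qed.

Lemma test_form_mul (chi : 'rV[R]_N -> R) phi : smooth chi -> test_form phi ->
  test_form (fun x V => chi x * phi x V).
Proof.
move=> chis [phic phis phik]; split.
- move=> x; have [pl pa] := phic x; split=> [i A B C b c rA rB rC|A i j ij rA].
    by rewrite (pl i A B C b c)//; ring.
  by rewrite (pa A i j)// mulr0.
- by move=> V; apply: smoothM.
- by apply: (subclosed_compact _ phik); [exact: closed_closure|exact: fsupp_mul].
Qed.

Lemma admissible_mul O U (chi : 'rV[R]_N -> R) phi : smooth chi ->
  (forall x, 0 <= chi x <= 1) -> admissible O phi ->
  fsupp (fun x V => chi x * phi x V) `<=` U ->
  admissible U (fun x V => chi x * phi x V).
Proof.
move=> chis chi01 [phit phi1 _] sU; split => //; first exact: test_form_mul.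
move=> x; apply/comass_le1P => xi xi1; have /andP[c0 c1] := chi01 x.
rewrite /pairing mulrCA; have /comass_le1P/(_ xi xi1) := phi1 x.
rewrite -/(pairing _ _) => h; apply: le_trans (ler_wpM2l c0 h) _.
by rewrite mulr1.
Qed.

Lemma admissible0 O : admissible O (fun _ _ => 0).
Proof.
have f0 : @fsupp R N n (fun _ _ => 0) = set0.
  rewrite /fsupp (_ : mkset _ = set0) ?closure0//.
  by apply/seteqP; split=> // x [V] /eqP.
split; [split|..].
- by move=> x; split=> [i A B C b c _ _ _|//]; rewrite !mulr0 addr0.
- by move=> V; exact: smooth_cst.
- by rewrite f0; exact: compact0.
- by move=> x; apply/comass_le1P => xi _; rewrite /pairing mulr0.
- by rewrite f0.
Qed.

Lemma subset_admissible O U : O `<=` U -> admissible O `<=` admissible U.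
Proof. by move=> OU phi [? ? /subset_trans]; split => //; auto. Qed.

(** At each point at least one of the two forms vanishes, so the comass of the sum is that of the
    other. The factor 1 gives the sum the shape found in [form_linear]. *)
Lemma admissibleU_disjoint O U phi psi : admissible O phi -> admissible U psi ->
  fsupp phi `&` fsupp psi = set0 ->
  admissible (O `|` U) (fun x V => 1 * phi x V + psi x V).
Proof.
move=> [[phic phis phik] phi1 phiO] [[psic psis psik] psi1 psiU] d.
have sub : fsupp (fun x V => 1 * phi x V + psi x V) `<=` fsupp phi `|` fsupp psi.
  rewrite /fsupp -closureU; apply: closureS => x [V].
  have [->|h _] := eqVneq (phi x V) 0; first by rewrite mulr0 add0r; right; exists V.
  by left; exists V.
split; [split|..].
- move=> x; have [pl pa] := phic x; have [ql qa] := psic x.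
  split=> [i A B C b c rA rB rC|A i j ij rA].
    by rewrite (pl i A B C b c)// (ql i A B C b c)//; ring.
  by rewrite (pa A i j)// (qa A i j)// mulr0 addr0.
- by move=> V; apply: smoothD => //; exact: smoothZ.
- apply: (subclosed_compact _ (compactU phik psik)) => //; exact: closed_closure.
- move=> x; have [xphi|xphi] := pselect (fsupp phi x).
    rewrite (_ : (fun V => _) = phi x)//; apply/funext => V.
    rewrite mul1r (_ : psi x V = 0) ?addr0//; apply: contrapT => /eqP p0.
    suff : (set0 : set 'rV[R]_N) x by [].
    by rewrite -d; split => //; apply: subset_closure; exists V.
  rewrite (_ : (fun V => _) = psi x)//; apply/funext => V.
  rewrite mul1r (_ : phi x V = 0) ?add0r//; apply: contrapT => /eqP p0.
  by apply: xphi; apply: subset_closure; exists V.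
- by apply: (subset_trans sub); apply: setUSS.
Qed.

Definition form_linear (S : functional R N n) :=
  forall (a : R) (phi psi : Defs.form R N n), test_form phi -> test_form psi ->
     S (fun x V => a * phi x V + psi x V) = a * S phi + S psi.

Variable S : functional R N n.
Hypothesis Slin : form_linear S.

Local Notation mo := (mass_open S).

Lemma mass_open_ub O phi : admissible O phi -> ((S phi)%:E <= mo O)%E.
Proof. by move=> ?; apply: ereal_sup_ubound; exists phi. Qed.

Lemma functional0 : S (fun _ _ => 0) = 0.
Proof.
have [t0 _ _] := admissible0 setT.
have := Slin 1 _ _ t0 t0; under eq_fun do under eq_fun do rewrite mulr0 addr0.
by rewrite mul1r => /eqP; rewrite -subr_eq0 opprD addNKr oppr_eq0 => /eqP.
Qed.

Lemma mass_open_ge0 O : (0 <= mo O)%E.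
Proof. by rewrite -[0%E]/(0%:E) -functional0; exact/mass_open_ub/admissible0. Qed.

Lemma mass_open0 : mo set0 = 0%E.
Proof.
apply/eqP; rewrite eq_le mass_open_ge0 andbT; apply: ge_ereal_sup => _ [phi [_ _ s0] <-].
rewrite (_ : phi = fun _ _ => 0) ?functional0//; apply/funext => x; apply/funext => V.
apply: contrapT => /eqP p0; apply: (s0 x).
by apply: subset_closure; exists V.
Qed.

Lemma le_mass_open O U : O `<=` U -> (mo O <= mo U)%E.
Proof.
move=> OU; apply: ge_ereal_sup => _ [phi /(subset_admissible _ _ OU) a <-].
exact: mass_open_ub.
Qed.

Lemma mass_openE O : open O -> mass S O = mo O.
Proof.
move=> oO; apply/eqP; rewrite eq_le; apply/andP; split.
  by apply: ereal_inf_lbound; exists O => //; split.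
by apply: le_ereal_inf_tmp => _ [U [_ OU] <-]; exact: le_mass_open.
Qed.

(** Split a competitor as chi phi + (1 - chi) phi, where chi is supported in [O] and equals 1 near
    the part of the support of phi outside [U]. *)
Lemma mass_openU O U : open O -> open U -> (mo (O `|` U) <= mo O + mo U)%E.
Proof.
move=> oO oU; apply: ge_ereal_sup => _ [phi ap <-].
have [phit _ phiOU] := ap; have [_ _ phik] := phit.
pose K := fsupp phi `&` ~` U.
have cK : compact K by apply: compact_closedI => //; exact: open_closedC.
have KO : K `<=` O by move=> x [/phiOU[//|Ux] /(_ Ux)].
have [chi [chis chi01 chiO [W [oW KW W1]]]] := smooth_urysohn K O cK oO KO.
have chi's : smooth (fun x => 1 + -1 * chi x).
  by apply: smoothD; [exact: smooth_cst|exact: smoothZ].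
have -> : phi = (fun x V => 1 * (chi x * phi x V) + (1 + -1 * chi x) * phi x V).
  by apply/funext => x; apply/funext => V; ring.
rewrite Slin; [|exact: test_form_mul..].
rewrite mul1r EFinD; apply: leeD; apply: mass_open_ub.
  apply: (admissible_mul (O `|` U)) => //; refine (subset_trans _ chiO).
  by apply: closureS => x [V]; rewrite mulf_eq0 negb_or => /andP[].
apply: (admissible_mul (O `|` U)) => //.
  by move=> x; have := chi01 x; lra.
(* The form (1 - chi) phi vanishes on [W]; since this set is closed, it contains the whole support,
   and it lies in [U]. *)
have cl : closed (fsupp phi `&` ~` W).
  by apply: closedI; [exact: closed_closure|exact: open_closedC].
refine (subset_trans (subset_trans (closureS _) cl) _).
  move=> x [V]; rewrite mulf_eq0 negb_or => /andP[h1 h2]; split.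
    by apply: subset_closure; exists V.
  by move=> /W1 cx; move: h1; rewrite cx mulN1r subrr eqxx.
by move=> x [sx nWx]; apply: contrapT => nUx; apply/nWx/KW.
Qed.

Lemma mass_open_bigsetU (F : nat -> set 'rV[R]_N) m : (forall i, open (F i)) ->
  (mo (\big[setU/set0]_(i < m) F i) <= \sum_(0 <= i < m) mo (F i))%E.
Proof.
move=> oF; rewrite big_mkord; elim: m => [|m ih]; first by rewrite !big_ord0 mass_open0.
rewrite !big_ord_recr/=; apply: (le_trans (mass_openU _ _ _ _)) => //.
  by apply: (big_ind open); [exact: open0|exact: openU|].
by rewrite leeD2r.
Qed.

(** The compact support of a competitor already lies in finitely many of the [F i], which reduces to
    finite subadditivity. *)
Lemma mass_open_bigcup (F : nat -> set 'rV[R]_N) : (forall i, open (F i)) ->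
  (mo (\bigcup_i F i) <= \sum_(0 <= i <oo) mo (F i))%E.
Proof.
move=> oF; apply: ge_ereal_sup => _ [phi [phit phi1 phiF] <-].
have [_ _ cphi] := phit.
have [m Hm] : exists m, fsupp phi `<=` \big[setU/set0]_(i < m) F i.
  move: cphi; rewrite compact_cover => /(_ nat setT F).
  case=> [//|x /phiF[i _ Fx]|D _ DF]; first by exists i.
  exists (\max_(i <- finmap.enum_fset D) i).+1 => x /DF[i /= iD Fix].
  rewrite -bigcup_mkord; exists i => //=; rewrite ltnS.
  by rewrite (big_rem i)//= leq_maxl.
apply: le_trans (mass_open_ub _ _ (And3 phit phi1 Hm)) _.
apply: le_trans (mass_open_bigsetU _ _ oF) _.
by apply: nneseries_lim_ge => i _ _; exact: mass_open_ge0.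
Qed.

Hypothesis Sfin : finite_mass S.

Lemma mass_ge0 A : (0 <= mass S A)%E.
Proof. by apply: le_ereal_inf_tmp => _ [U _ <-]; exact: mass_open_ge0. Qed.

Lemma mass_set0 : mass S set0 = 0%E.
Proof. by rewrite mass_openE ?mass_open0//; exact: open0. Qed.

Lemma le_mass : {homo mass S : A B / A `<=` B >-> (A <= B)%E}.
Proof.
move=> A B AB; apply: le_ereal_inf_tmp => _ [U [oU BU] <-].
by apply: ereal_inf_lbound; exists U => //; split => //; exact: subset_trans BU.
Qed.

Lemma mass_fin_num A : mass S A \is a fin_num.
Proof.
rewrite ge0_fin_numE ?mass_ge0//; apply: le_lt_trans Sfin.
by rewrite -(mass_openE setT) ?le_mass//; exact: openT.
Qed.

Lemma mass_open_adherent A (e : R) : 0 < e ->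
  exists U, [/\ open U, A `<=` U & (mo U <= mass S A + e%:E)%E].
Proof.
move=> e0; have := lb_ereal_inf_adherent e0 (mass_fin_num A).
by move=> [_ [U [oU AU] <-]] /ltW h; exists U.
Qed.

Lemma mass_sigma_subadditive : sigma_subadditive (mass S).
Proof.
move=> F; apply/lee_addgt0Pr => e e0.
have /choice[G HG] : forall i, exists U, [/\ open U, F i `<=` U &
    (mo U <= mass S (F i) + (e / (2 ^ i.+1)%:R)%:E)%E].
  move=> i; apply: mass_open_adherent.
  by rewrite divr_gt0// ltr0n expn_gt0.
apply: le_trans (epsilon_trick _ (fun=> mass_ge0 _) (ltW e0)).
apply: (@le_trans _ _ (\sum_(i <oo) mo (G i))%E); last first.
  by apply: lee_nneseries => i _ *; [exact: mass_open_ge0|by have [] := HG i].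
apply: le_trans (mass_open_bigcup _ _); last by move=> i; have [] := HG i.
rewrite -mass_openE; last by apply: bigcup_open => i _; have [] := HG i.
by apply: le_mass; apply: subset_bigcup => i _; have [] := HG i.
Qed.

(** Let [V] be open and contain the test set. For phi supported in [V] and [U], and psi supported in
    [V] minus the support of phi, the sum is a competitor for [V]. Taking suprema first over psi,
    then over phi, gives the inequality, because [V] minus the support of phi contains [V] minus
    [U]. *)
Lemma mass_caratheodory U : open U -> caratheodory_measurable (mass S) U.
Proof.
move=> oU.
pose M : {outer_measure set 'rV[R]_N -> \bar R} := HB.pack (mass S)
  (isOuterMeasure.Build R _ (mass S) mass_set0 mass_ge0 le_mass mass_sigma_subadditive).
apply: (@le_caratheodory_measurable _ _ M) => X /=; rewrite /M/=.
apply: le_ereal_inf_tmp => _ [V [oV XV] <-].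
apply: (@le_trans _ _ (mass S (V `&` U) + mass S (V `&` ~` U))%E).
  by apply: leeD; apply: le_mass; exact: setSI.
have oVU : open (V `&` U) by exact: openI.
rewrite (mass_openE _ oVU) -leeBrDr; last exact: mass_fin_num.
apply: ge_ereal_sup => _ [phi aphi <-].
have [[_ _ cphi] _ phiVU] := aphi.
rewrite leeBrDr ?mass_fin_num// addeC -leeBrDr//.
have oVK : open (V `\` fsupp phi).
  by rewrite setDE; apply: openI => //; apply: closed_openC; exact: closed_closure.
apply: (@le_trans _ _ (mo (V `\` fsupp phi))).
  rewrite -mass_openE//; apply: le_mass => x [Vx nUx]; split => // /phiVU[_ Ux].
  exact: nUx.
apply: ge_ereal_sup => _ [psi apsi <-].
have [_ _ psiV] := apsi.
have disj : fsupp phi `&` fsupp psi = set0.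
  by apply/seteqP; split=> // x [phix /psiV[_]]; exact.
have a := admissibleU_disjoint _ _ _ _ aphi apsi disj.
have VV : (V `&` U) `|` (V `\` fsupp phi) `<=` V by move=> x [[]|[]].
have := mass_open_ub _ _ (subset_admissible _ _ VV _ a).
have [tphi _ _] := aphi; have [tpsi _ _] := apsi.
by rewrite Slin// mul1r leeBrDr// EFinD addeC.
Qed.

(** The Caratheodory measurable sets form a sigma-algebra containing the open sets, hence all Borel
    sets, and the outer measure is additive there. *)
Lemma mass_sigma_additive :
  semi_sigma_additive (mass S : set (@borel_space R N) -> \bar R).
Proof.
pose M : {outer_measure set 'rV[R]_N -> \bar R} := HB.pack (mass S)
  (isOuterMeasure.Build R _ (mass S) mass_set0 mass_ge0 le_mass mass_sigma_subadditive).
have bc (A : set (@borel_space R N)) : measurable A -> caratheodory_measurable M A.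
  move: A; apply: smallest_sub; last exact: mass_caratheodory.
  split.
  - exact: caratheodory_measurable_set0.
  - by move=> A mA; rewrite setTD; exact: caratheodory_measurable_setC.
  - by move=> A mA; exact: caratheodory_measurable_bigcup.
move=> F mF tF mUF.
have h := @caratheodory_measure_sigma_additive R _ M F
  (fun i => bc _ (mF i)) tF (bc _ mUF).
exact: h.
Qed.

(** The two proofs are carried as arguments so that the finite measure structure can be attached to
    [mass S], which is a measure only under these hypotheses. *)
Definition mass_measure of form_linear S & finite_mass S :
  set (@borel_space R N) -> \bar R := mass S.

Local Notation mu := (mass_measure Slin Sfin).

HB.instance Definition _ :=
  isMeasure.Build _ _ R mu mass_set0 mass_ge0 mass_sigma_additive.

HB.instance Definition _ :=
  Measure_isFinite.Build _ _ R mu (fun A _ => mass_fin_num A).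

End MassMeasure.

(** * Weak convergence of measures *)

Section BoundedMeasurable.
Context {d : measure_display} {T : measurableType d} {R : realType}.
Variable mu : {finite_measure set T -> \bar R}.
Implicit Types f g : T -> R.

(** A class closed under sums and products and integrable for every finite measure, so one side
    condition serves all the measures below. *)
Definition bounded_measurable f :=
  measurable_fun setT f /\ exists B : R, forall x, `|f x| <= B.

Lemma bounded_measurable_cst c : bounded_measurable (fun=> c).
Proof. by split; [exact: measurable_cst|exists `|c|]. Qed.

Lemma bounded_measurableD f g : bounded_measurable f -> bounded_measurable g ->
  bounded_measurable (fun x => f x + g x).
Proof.
move=> [mf [B fB]] [mg [C gC]]; split; first exact: measurable_funD.
by exists (B + C) => x; rewrite (le_trans (ler_normD _ _))// lerD.
Qed.

Lemma bounded_measurableM f g : bounded_measurable f -> bounded_measurable g ->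
  bounded_measurable (fun x => f x * g x).
Proof.
move=> [mf [B fB]] [mg [C gC]]; split; first exact: measurable_funM.
by exists (B * C) => x; rewrite normrM ler_pM.
Qed.

Lemma bounded_measurableZ c f : bounded_measurable f ->
  bounded_measurable (fun x => c * f x).
Proof. by apply: bounded_measurableM; exact: bounded_measurable_cst. Qed.

Lemma bounded_measurable_sum I (r : seq I) (F : I -> T -> R) :
  (forall i, bounded_measurable (F i)) ->
  bounded_measurable (fun x => \sum_(i <- r) F i x).
Proof.
move=> hF; elim: r => [|i r ih].
  by under eq_fun do rewrite big_nil; exact: bounded_measurable_cst.
by under eq_fun do rewrite big_cons; exact: bounded_measurableD.
Qed.

Lemma bounded_measurable_indic (A : set T) : measurable A ->
  bounded_measurable (fun x => \1_A x).
Proof.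
move=> mA; split; first exact: measurable_indic.
by exists 1 => x; rewrite indicE; case: (x \in A); rewrite ?normr1 ?normr0.
Qed.

Lemma bounded_measurable_integrable f : bounded_measurable f ->
  mu.-integrable setT (EFin \o f).
Proof.
move=> [mf [B fB]]; apply: measurable_bounded_integrable => //.
- by rewrite -ge0_fin_numE// fin_num_measure.
- exists B; split; first exact: num_real.
  by move=> C BC x _; rewrite /= (le_trans (fB x))// ltW.
Qed.

Local Notation I f := (\int[mu]_x f x).

Lemma RintegralEFin f : bounded_measurable f -> (\int[mu]_x (f x)%:E)%E = (I f)%:E.
Proof.
move=> bf; rewrite fineK//; apply: integrable_fin_num => //.
exact: bounded_measurable_integrable.
Qed.

Lemma bRintegralD f g : bounded_measurable f -> bounded_measurable g ->
  \int[mu]_x (f x + g x) = I f + I g.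
Proof. by move=> bf bg; apply: RintegralD => //; exact: bounded_measurable_integrable. Qed.

Lemma bRintegralZ c f : bounded_measurable f -> \int[mu]_x (c * f x) = c * I f.
Proof. by move=> bf; apply: RintegralZl => //; exact: bounded_measurable_integrable. Qed.

Lemma bRintegral_sum J (r : seq J) (F : J -> T -> R) :
  (forall i, bounded_measurable (F i)) ->
  \int[mu]_x (\sum_(i <- r) F i x) = \sum_(i <- r) I (F i).
Proof.
move=> hF; elim: r => [|i r ih].
  under eq_Rintegral do rewrite big_nil.
  by rewrite Rintegral_cst// mul0r big_nil.
under eq_Rintegral do rewrite big_cons.
by rewrite bRintegralD// ?ih ?big_cons//; exact: bounded_measurable_sum.
Qed.

Lemma ble_Rintegral f g : bounded_measurable f -> bounded_measurable g ->
  (forall x, f x <= g x) -> I f <= I g.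
Proof.
by move=> bf bg fg; apply: le_Rintegral => //; exact: bounded_measurable_integrable.
Qed.

Lemma bRintegral_indic (A : set T) : measurable A -> \int[mu]_x (\1_A x) = fine (mu A).
Proof. by move=> mA; rewrite /Rintegral integral_indic// setIT. Qed.

Lemma bounded_cvg_Rintegral (f_ : nat -> T -> R) f B :
  (forall m, measurable_fun setT (f_ m)) -> measurable_fun setT f ->
  (forall m x, `|f_ m x| <= B) -> (forall x, f_ ^~ x @ \oo --> f x) ->
  (fun m => I (f_ m)) @ \oo --> I f.
Proof.
move=> mf_ mf fB f_f.
have [] := @dominated_convergence _ _ _ mu setT measurableT
  (fun m => EFin \o f_ m) (EFin \o f) (cst B%:E).
- by move=> m; exact/measurable_EFinP.
- exact/measurable_EFinP.
- by apply: aeW => x _; apply/fine_cvgP; split; [exact: nearW|exact: f_f].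
- exact: (bounded_measurable_integrable (fun=> B) (bounded_measurable_cst B)).
- by apply: aeW => x m _; rewrite lee_fin.
move=> _ _; have bf : bounded_measurable f.
  split=> //; exists B => x; have fx := f_f x.
  have : (fun m => `|f_ m x|) @ \oo --> `|f x| by exact: cvg_norm.
  by move/cvgr_to_le; apply; exact: nearW.
rewrite (_ : (\int[mu]_x (EFin \o f) x)%E = (I f)%:E); last exact: RintegralEFin.
exact: fine_cvg.
Qed.

End BoundedMeasurable.

Section Staircase.
Context {R : realType}.

(* c J s / J is the staircase approximation from below of t = s / J in [0, 1]
   by the indicators of the superlevel sets {t > (j + 1) / J}. *)
Let c (J : nat) (s : R) : R := \sum_(j < J) (j.+1%:R < s)%R%:R.

(** The bound by [J] carries the induction: the new term counts only when s > J + 1, and then the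
    sum is at most J + 1. *)
Lemma staircase_le J (s : R) : 0 <= s -> c J s <= s /\ c J s <= J%:R.
Proof.
move=> s0; rewrite /c; elim: J => [|J [ih1 ih2]]; first by rewrite big_ord0.
rewrite big_ord_recr/= -natr1.
move: (\sum_(_ < J) _) ih1 ih2 => S ih1 ih2.
case: ltrP => h /=; rewrite ?mulr1n ?addr0; split; lra.
Qed.

Lemma staircase_ge J (s : R) : s <= J%:R -> s <= 1 + c J s.
Proof.
(* The induction also needs the case s > J, in which every term counts. *)
suff : if s <= J%:R then s <= 1 + c J s else c J s == J%:R.
  by move=> h sJ; rewrite sJ in h.
rewrite /c; elim: J => [|J]; first by rewrite big_ord0; case: ifPn => //; lra.
rewrite big_ord_recr/= -natr1; move: (\sum_(_ < J) _) => S.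
case: (lerP s J%:R) => sJ ih.
  rewrite ifT; last lra.
  by case: ltrP => ? /=; rewrite ?mulr1n ?addr0; lra.
move/eqP: ih => ->; have [h|h] := lerP s (J%:R + 1).
  by rewrite addr0; lra.
by rewrite mulr1n.
Qed.

End Staircase.

(** * From semicontinuity on open sets to convergence of integrals *)

Section WeakConvergence.
Context {R : realType} {N : nat}.
Local Notation X := (@borel_space R N).

Lemma continuous_borel (f : 'rV[R]_N -> R) : continuous f ->
  measurable_fun setT (f : X -> R).
Proof.
move=> cf; apply: (measurability _ (RGenOInfty.measurableE R)).
move=> _ [_ [a ->] <-]; rewrite setTI; apply: sub_sigma_algebra.
by apply: open_comp; [move=> x _; exact: cf|exact: interval_open].
Qed.

Lemma open_borel (U : set 'rV[R]_N) : open U -> measurable (U : set X).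
Proof. by move=> oU; exact: sub_sigma_algebra. Qed.

Variables (mu_ : nat -> {finite_measure set X -> \bar R})
  (mu : {finite_measure set X -> \bar R}).
Hypothesis lsc : forall U : set 'rV[R]_N, open U -> forall e, 0 < e ->
  \forall i \near \oo, fine (mu U) - e <= fine (mu_ i U).
Hypothesis total : (fun i => fine (mu_ i setT)) @ \oo --> fine (mu setT).

(** A sum of indicators of the open sets f > (j + 1) / J approximates J f from below within 1, and
    semicontinuity applies to each of these sets. *)
Lemma Rintegral_lsc01 (f : 'rV[R]_N -> R) (e : R) : continuous f ->
  (forall x, 0 <= f x <= 1) -> 0 < e ->
  \forall i \near \oo, \int[mu]_x f x - e <= \int[mu_ i]_x f x.
Proof.
move=> cf f01 e0.
have bf : bounded_measurable (f : X -> R).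
  split; first exact: continuous_borel.
  by exists 1 => x; have /andP[? ?] := f01 x; rewrite ger0_norm.
pose M := fine (mu setT).
have M0 : 0 <= M by rewrite fine_ge0.
(* With this [J], the staircase error [M] is at most J e / 2; the other J e / 2 pays for a loss of e
   / 2 on each of the [J] sets. *)
have [J0 HJ0] : exists J, 2 * M / e <= J.+1%:R :> R.
  exists (Num.truncn (2 * M / e)); apply/ltW/truncnS_gt.
set J := J0.+1 in HJ0; have J_gt0 : 0 < J%:R :> R by [].
pose U (j : 'I_J) : set 'rV[R]_N := [set x | j.+1%:R < J%:R * f x].
have oU j : open (U j).
  apply: (@open_comp _ _ (fun x => J%:R * f x) [set t | j.+1%:R < t]); last exact: open_gt.
  by move=> x _; exact: (continuousM (@cst_continuous _ _ (J%:R : R) x) (cf x)).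
have mU j : measurable (U j : set X) by exact: open_borel.
pose c x : R := \sum_(j < J) \1_(U j) x.
have cE x : c x = \sum_(j < J) (j.+1%:R < J%:R * f x)%R%:R.
  apply: eq_bigr => j _; rewrite indicE; congr (nat_of_bool _)%:R.
  by apply/idP/idP; rewrite inE.
have bU j : bounded_measurable (\1_(U j) : X -> R) by exact: bounded_measurable_indic.
have bc : bounded_measurable (c : X -> R) by exact: bounded_measurable_sum.
have Ic (nu : {finite_measure set X -> \bar R}) :
    \int[nu]_x c x = \sum_(j < J) fine (nu (U j)).
  rewrite bRintegral_sum//; apply: eq_bigr => j _; exact: bRintegral_indic.
have lo (nu : {finite_measure set X -> \bar R}) :
    \sum_(j < J) fine (nu (U j)) <= J%:R * \int[nu]_x f x.
  rewrite -Ic -bRintegralZ//; apply: ble_Rintegral => //; first exact: bounded_measurableZ.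
  move=> x; have /andP[f0 _] := f01 x; rewrite cE.
  by apply: (proj1 (staircase_le _ _ _)); rewrite mulr_ge0// ltW.
have up : J%:R * \int[mu]_x f x <= M + \sum_(j < J) fine (mu (U j)).
  rewrite -Ic -bRintegralZ// -[M]mul1r -Rintegral_cst// -bRintegralD//;
    last exact: bounded_measurable_cst.
  apply: ble_Rintegral; first exact: bounded_measurableZ.
    by apply: bounded_measurableD => //; exact: bounded_measurable_cst.
  move=> x; have /andP[f0 f1] := f01 x; rewrite cE.
  by apply: staircase_ge; rewrite ler_piMr// ltW.
have e2 : 0 < e / 2 by rewrite divr_gt0.
near=> i.
have H j : fine (mu (U j)) - e / 2 <= fine (mu_ i (U j)).
  by move: j; near: i; apply: filter_forall => j; exact: lsc.
have : J%:R * (\int[mu]_x f x - e) <= J%:R * \int[mu_ i]_x f x; last by rewrite ler_pM2l.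
apply: le_trans (lo (mu_ i)).
apply: (@le_trans _ _ (\sum_(j < J) (fine (mu (U j)) - e / 2))); last exact: ler_sum.
rewrite sumrB sumr_const card_ord -[_ *+ J]mulr_natl mulrBr.
have : M <= J%:R * (e / 2).
  by move: HJ0; rewrite ler_pdivrMr//; lra.
by move: up; lra.
Unshelve. all: by end_near.
Qed.

(** The affine change a f + 1/2 maps into [0, 1]. Its constant term contributes half the total mass
    of [mu_ i], which is controlled from above by [total]. *)
Lemma Rintegral_lsc (f : 'rV[R]_N -> R) (B e : R) : continuous f ->
  (forall x, `|f x| <= B) -> 0 < e ->
  \forall i \near \oo, \int[mu]_x f x - e <= \int[mu_ i]_x f x.
Proof.
move=> cf fB e0.
have B0 : 0 <= B by exact: le_trans (fB 0).
pose C := B + 1; have C0 : 0 < C by rewrite ltr_wpDl.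
pose a : R := (2 * C)^-1; have a0 : 0 < a by rewrite invr_gt0 mulr_gt0.
have aC : a * C = 2^-1 by rewrite /a invfM mulfVK// gt_eqF.
have bf : bounded_measurable (f : X -> R).
  by split; [exact: continuous_borel|exists B].
have Ig (nu : {finite_measure set X -> \bar R}) :
    \int[nu]_x (a * f x + 2^-1) = a * \int[nu]_x f x + 2^-1 * fine (nu setT).
  rewrite bRintegralD ?bRintegralZ ?Rintegral_cst//.
    exact: bounded_measurableZ.
  exact: bounded_measurable_cst.
have e1 : 0 < a * (e / 2) by rewrite mulr_gt0// divr_gt0.
near=> i.
have h1 : \int[mu]_x (a * f x + 2^-1) - a * (e / 2) <= \int[mu_ i]_x (a * f x + 2^-1).
  near: i; apply: Rintegral_lsc01 => //.
    move=> x; apply: (continuousD _ (@cst_continuous _ _ (2^-1 : R) x)).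
    exact: (continuousM (@cst_continuous _ _ a x) (cf x)).
  move=> x; have : `|a * f x| <= 2^-1.
    by rewrite normrM gtr0_norm// -aC ler_pM2l// (le_trans (fB x))// lerDl.
  by rewrite ler_norml; lra.
have h2 : fine (mu_ i setT) <= fine (mu setT) + a * e.
  near: i; by apply: (cvgr_le _ total); rewrite ltrDl mulr_gt0.
rewrite -(ler_pM2l a0); move: h1; rewrite !Ig mulrBr; lra.
Unshelve. all: by end_near.
Qed.

(** Lower semicontinuity is applied to both f and -f. *)
Lemma Rintegral_weak_cvg (f : 'rV[R]_N -> R) (B : R) : continuous f ->
  (forall x, `|f x| <= B) ->
  (fun i => \int[mu_ i]_x f x) @ \oo --> \int[mu]_x f x.
Proof.
move=> cf fB.
have bf : bounded_measurable (f : X -> R).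
  by split; [exact: continuous_borel|exists B].
apply/cvgrPdist_le => e e0; near=> i.
have h1 : \int[mu]_x f x - e <= \int[mu_ i]_x f x.
  by near: i; exact: Rintegral_lsc.
have h2 : \int[mu]_x (-1 * f x) - e <= \int[mu_ i]_x (-1 * f x).
  near: i; apply: (@Rintegral_lsc _ B) => //.
    move=> x; exact: (continuousM (@cst_continuous _ _ (-1 : R) x) (cf x)).
  by move=> x; rewrite mulN1r normrN.
by move: h2; rewrite !bRintegralZ// ler_norml; lra.
Unshelve. all: by end_near.
Qed.

End WeakConvergence.

(** * Gram matrices and Rayleigh quotients *)

Section QuadraticForms.
Context {R : realType} {k : nat}.
Implicit Types (A D : 'I_k -> 'I_k -> R) (c : 'I_k -> R).

Definition quad A c : R := \sum_p \sum_q c p * c q * A p q.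

Definition norm2 c : R := \sum_p c p ^+ 2.

Lemma norm2_ge0 c : 0 <= norm2 c.
Proof. by apply: sumr_ge0 => p _; exact: sqr_ge0. Qed.

Lemma norm2_gt0 c p : c p != 0 -> 0 < norm2 c.
Proof.
move=> cp; rewrite /norm2 (bigD1 p)//= ltr_pwDl//; first by rewrite exprn_even_gt0.
by apply: sumr_ge0 => q _; exact: sqr_ge0.
Qed.

Lemma quad_close A D (e : R) c : (forall p q, `|D p q - A p q| <= e) ->
  `|quad D c - quad A c| <= e * k%:R * norm2 c.
Proof.
move=> h; rewrite /quad -sumrB.
(* The bound is spread over the pairs (p, q) to match |c_p c_q| <= (c_p^2 + c_q^2) / 2 term by
   term. *)
rewrite (_ : e * k%:R * norm2 c =
    \sum_(p < k) \sum_(q < k) e / 2 * (c p ^+ 2 + c q ^+ 2)); last first.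
  under eq_bigr do rewrite -mulr_sumr big_split/= sumr_const card_ord.
  rewrite -mulr_sumr big_split/= sumrMnl sumr_const card_ord -/(norm2 c).
  by rewrite -mulr_natl; field.
apply: le_trans (ler_norm_sum _ _ _) _; apply: ler_sum => p _.
rewrite -sumrB; apply: le_trans (ler_norm_sum _ _ _) _; apply: ler_sum => q _.
rewrite -mulrBr normrM.
have e0 : 0 <= e by exact: le_trans (h p q).
have : `|c p * c q| <= (c p ^+ 2 + c q ^+ 2) / 2.
  rewrite ler_norml; have := sqr_ge0 (c p + c q); have := sqr_ge0 (c p - c q).
  by rewrite !expr2; lra.
move=> h2; apply: le_trans (ler_pM _ _ h2 (h p q)) _ => //.
by rewrite mulrC mulrA mulrAC.
Qed.

Lemma quadZ A (a : R) c : quad A (fun p => a * c p) = a ^+ 2 * quad A c.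
Proof.
rewrite /quad mulr_sumr; apply: eq_bigr => p _; rewrite mulr_sumr.
by apply: eq_bigr => q _; ring.
Qed.

(** The constant is the minimum of the form on the compact unit sphere; homogeneity extends the
    bound to all [c]. *)
Lemma quad_coercive A : (forall c p, c p != 0 -> 0 < quad A c) ->
  exists2 r : R, 0 < r & forall c, r * norm2 c <= quad A c.
Proof.
move=> Apos.
have q0 c : (forall p, c p = 0) -> quad A c = 0.
  by move=> c0; rewrite /quad big1// => p _; rewrite big1// => q _; rewrite c0 !mul0r.
pose K := [set x : 'rV[R]_k | norm2 (x 0) = 1].
pose f (x : 'rV[R]_k) := quad A (x 0).
have fs : smooth f.
  rewrite /f /quad; apply: smooth_sum => p; apply: smooth_sum => q.
  by apply: smoothM; [apply: smoothM; exact: smooth_coord|exact: smooth_cst].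
have ns : smooth (fun x : 'rV[R]_k => norm2 (x 0)).
  rewrite /norm2; apply: smooth_sum => p; under eq_fun do rewrite expr2.
  by apply: smoothM; exact: smooth_coord.
have K_of c p : c p != 0 -> exists2 a : R, a ^+ 2 * norm2 c = 1 &
    K (\row_q (a * c q)).
  move=> cp; have n0 := norm2_gt0 c p cp; exists (Num.sqrt (norm2 c))^-1.
    by rewrite exprVn sqr_sqrtr ?norm2_ge0// mulVf// gt_eqF.
  rewrite /K/= /norm2; under eq_bigr do rewrite mxE exprMn.
  by rewrite -mulr_sumr exprVn sqr_sqrtr ?norm2_ge0// mulVf// gt_eqF.
have cK : compact K.
  apply: bounded_closed_compact.
    exists 1; split => // M M1 x Kx /=; rewrite [leLHS]/Num.norm/= mx_normrE.
    apply: bigmax_le => [|[i j] _]/=; first by rewrite (le_trans _ (ltW M1)).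
    rewrite (le_trans _ (ltW M1))// ord1 -ler_sqr ?nnegrE// expr1n real_normK ?num_real//.
    by rewrite -Kx /norm2 (bigD1 j)//= lerDl sumr_ge0// => q _; exact: sqr_ge0.
  apply: (@closed_comp _ _ (fun x : 'rV[R]_k => norm2 (x 0)) [set t | t = 1]).
    by move=> x _; exact: smooth_cont.
  exact: closed_eq.
have n0 c : ~ (exists p, c p != 0) -> forall p, c p = 0.
  by move=> h p; apply: contrapT => /eqP cp; apply: h; exists p.
have fE c a : f (\row_q (a * c q)) = a ^+ 2 * quad A c.
  rewrite -quadZ /f /quad; apply: eq_bigr => p _; apply: eq_bigr => q _.
  by rewrite !mxE.
suff [r r0 Hr] : exists2 r : R, 0 < r & forall x, K x -> r <= f x.
  exists r => // c; have [[p cp]|h] := pselect (exists p, c p != 0).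
    have [a a1 /Hr] := K_of c p cp; rewrite fE => ha.
    have a2 : 0 < a ^+ 2.
      rewrite lt_def sqr_ge0 andbT; apply: contra_eq_neq a1 => ->.
      by rewrite mul0r eq_sym oner_neq0.
    by rewrite -(ler_pM2l a2) mulrCA a1 mulr1.
  have {}h := n0 c h; rewrite q0// /norm2 big1 ?mulr0// => p _.
  by rewrite h expr0n.
(* The sphere is empty when [k = 0]. *)
have [K0|/set0P K0] := eqVneq K set0; first by exists 1 => // x; rewrite K0.
have [x0 Kx0 mx0] := compact_EVT_min K0 cK (continuous_subspaceT (smooth_cont _ fs)).
rewrite inE in Kx0; exists (f x0); last by move=> x Kx; apply: mx0; rewrite inE.
have [[p cp]|/n0 h] := pselect (exists p, x0 0 p != 0); first exact: Apos cp.
have := Kx0; rewrite /K/= /norm2 big1 => [|p _]; last by rewrite h expr0n.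
by move=> /esym/eqP; rewrite oner_eq0.
Qed.

(** The slack (M' - M) [quad A c] is at least (M' - M) r |c|^2 by coercivity, and this absorbs the
    perturbations of both forms. *)
Lemma quad_ratio A D (M M' : R) : M < M' ->
  (forall c p, c p != 0 -> 0 < quad A c) -> (forall c, quad D c <= M * quad A c) ->
  exists2 e : R, 0 < e & forall A' D', (forall p q, `|A' p q - A p q| <= e) ->
    (forall p q, `|D' p q - D p q| <= e) ->
    forall c p, c p != 0 -> 0 < quad A' c /\ quad D' c <= M' * quad A' c.
Proof.
move=> MM' Apos DA; have [r r0 Hr] := quad_coercive A Apos.
have m0 : 0 < 1 + `|M'| by rewrite ltr_pwDl.
(* The first bound keeps the perturbed [A'] positive; the second covers an error d |c|^2 from [D']
   and |M'| d |c|^2 from [A']. *)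
pose d := Num.min (r / 2) ((M' - M) * r / (1 + `|M'|)).
have d0 : 0 < d by rewrite lt_min !divr_gt0// mulr_gt0// subr_gt0.
have k0 : 0 < k.+1%:R :> R by [].
(* [quad_close] costs a factor [k]; dividing by [k + 1] stays meaningful for [k = 0]. *)
exists (d / k.+1%:R); first by rewrite divr_gt0.
move=> A' D' hA hD c p cp.
have n0 := norm2_gt0 c p cp.
have dk : d / k.+1%:R * k%:R <= d.
  by rewrite mulrAC ler_pdivrMr// ler_pM2l// ler_nat.
have {}hA : `|quad A' c - quad A c| <= d * norm2 c.
  by apply: le_trans (quad_close _ _ _ c hA) _; rewrite ler_wpM2r// ltW.
have {}hD : `|quad D' c - quad D c| <= d * norm2 c.
  by apply: le_trans (quad_close _ _ _ c hD) _; rewrite ler_wpM2r// ltW.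
have rA := Hr c; have DAc := DA c.
have d1 : d * norm2 c <= r / 2 * norm2 c by rewrite ler_pM2r// ge_min lexx.
have d2 : d * norm2 c * (1 + `|M'|) <= (M' - M) * quad A c.
  apply: (@le_trans _ _ ((M' - M) * (r * norm2 c))); last by rewrite ler_pM2l// subr_gt0.
  by rewrite mulrAC mulrA ler_pM2r// -ler_pdivlMr// ge_min lexx orbT.
have rn : 0 < r * norm2 c by rewrite mulr_gt0.
split; first by move: hA; rewrite ler_norml; lra.
have hM : `|M' * (quad A' c - quad A c)| <= `|M'| * (d * norm2 c).
  by rewrite normrM ler_wpM2l.
by move: hM hD; rewrite !ler_norml; lra.
Qed.

End QuadraticForms.

(** * Compactly supported functions and separation from a set *)

Section CompactSupport.
Context {R : realType} {N : nat}.
Implicit Types (f : 'rV[R]_N -> R).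

Lemma notin_supp f x : ~ supp f x -> f x = 0.
Proof. by move=> h; apply: contrapT => /eqP fx; apply: h; exact: subset_closure. Qed.

Lemma partial_supp l f : supp (partial l f) `<=` supp f.
Proof.
have cl : closed (supp f) by exact: closed_closure.
refine (subset_trans (closureS _) cl) => x /= h; apply: contrapT => nx.
move/eqP: h; apply; rewrite /partial.
rewrite -(derive_cst (0 : R) x (delta_mx 0 l)); apply: near_eq_derive.
have : nbhs x (~` supp f).
  by apply: open_nbhs_nbhs; split => //; apply: closed_openC; exact: closed_closure.
by apply: filterS => y; exact: notin_supp.
Qed.

Lemma compact_supp_bounded f : continuous f -> compact (supp f) ->
  exists B : R, forall x, `|f x| <= B.
Proof.
move=> cf kf; have [K0|/set0P K0] := eqVneq (supp f) set0.
  by exists 0 => x; rewrite notin_supp ?normr0// K0.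
have cn : continuous (fun x => `|f x|).
  by move=> x; apply: continuous_comp; [exact: cf|exact: norm_continuous].
have [x0 _ mx0] := compact_EVT_max K0 kf (continuous_subspaceT cn).
exists `|f x0| => x; have [sx|nx] := pselect (supp f x); first by apply: mx0; rewrite inE.
by rewrite notin_supp// normr0.
Qed.

Lemma smooth_bounded_measurable f : smooth f -> compact (supp f) ->
  bounded_measurable (f : @borel_space R N -> R).
Proof.
move=> fs fk; split; first exact: (continuous_borel _ (smooth_cont _ fs)).
by apply: compact_supp_bounded => //; exact: smooth_cont.
Qed.

Lemma compact_partial_supp l f : compact (supp f) -> compact (supp (partial l f)).
Proof.
by move=> fk; apply: (subclosed_compact _ fk); [exact: closed_closure|exact: partial_supp].
Qed.

Lemma partial_sum k (c : 'I_k -> R) (v : 'I_k -> 'rV[R]_N -> R) l x :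
  (forall p, smooth (v p)) ->
  partial l (fun y => \sum_p c p * v p y) x = \sum_p c p * partial l (v p) x.
Proof.
move=> vs; rewrite /partial.
rewrite (_ : (fun y => _) = \sum_p (c p \*: v p)); last first.
  by apply/funext => y; rewrite fct_sumE.
rewrite derive_sum => [|p]; last first.
  by apply: derivableZ; apply: diff_derivable; exact: smooth_diff.
by apply: eq_bigr => p _; rewrite deriveZ//; apply: diff_derivable; exact: smooth_diff.
Qed.

(** Each point of [P] has a ball missing [D]; half its radius works at all nearby points, and
    compactness makes the choice uniform. The separation is found in the sup norm and passes to the
    larger Euclidean norm. *)
Lemma nbhd_separated (P D : set 'rV[R]_N) : compact P ->
  (forall x, P x -> ~ closure D x) ->
  exists2 e : R, 0 < e & forall x, P x -> ~ nbhd D e x.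
Proof.
move=> cP PD.
have near_sep : \forall e \near 0^'+, P `<=` (fun x => forall a, D a -> e <= `|x - a|).
  move/compact_near_coveringP : cP; apply => x Px.
  have : nbhs x (~` closure D).
    by apply: open_nbhs_nbhs; split; [apply: closed_openC; exact: closed_closure|exact: PD].
  move=> /nbhs_ballP[r /= r0 rD].
  have r2 : 0 < r / 2 by rewrite divr_gt0.
  near=> x' e.
  have he : e < r / 2 by near: e; exact: nbhs_right_lt.
  have hx' : ball x (r / 2) x' by near: x'; exact: nbhsx_ballx.
  rewrite -ball_normE/= in hx'.
  move=> a Da; rewrite leNgt; apply/negP => xa.
  apply: (rD a); last exact: subset_closure.
  rewrite -ball_normE/=; apply: le_lt_trans (ler_distD x' _ _) _.
  by rewrite [r]splitr; apply: ltrD => //; exact: lt_trans xa _.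
have [e [e0 He]] : exists e : R,
    0 < e /\ P `<=` (fun x => forall a, D a -> e <= `|x - a|).
  near (0 : R)^'+ => e; exists e; split; first by near: e; exact: nbhs_right_gt.
  by near: e.
exists e => // x Px; rewrite /nbhd/= => h.
have [_ [a Da <-]] := ereal_inf_lt h; rewrite lte_fin.
move=> h2; have := He x Px a Da; apply/negP; rewrite -ltNge; apply: le_lt_trans h2.
rewrite [leLHS]/Num.norm/= mx_normrE.
apply: bigmax_le => [|[i j] _]/=; first exact: sqrtr_ge0.
rewrite ord1 -ler_sqr ?nnegrE ?sqrtr_ge0// real_normK ?num_real//.
rewrite sqr_sqrtr; last by apply: sumr_ge0 => q _; exact: sqr_ge0.
by rewrite (bigD1 j)//= lerDl sumr_ge0// => q _; exact: sqr_ge0.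
Unshelve. all: by end_near.
Qed.

End CompactSupport.

(** * Gram and energy matrices *)

Section Gram.
Context {R : realType} {N k : nat}.
Local Notation X := (@borel_space R N).
Implicit Types (nu : {finite_measure set X -> \bar R}) (w v : 'I_k -> 'rV[R]_N -> R).

Definition gram nu w (p q : 'I_k) : R := \int[nu]_x (w p x * w q x).

Definition energy nu v (p q : 'I_k) : R :=
  \sum_l gram nu (fun p => partial l (v p)) p q.

Lemma quad_gram nu w c : (forall p, bounded_measurable (w p : X -> R)) ->
  quad (gram nu w) c = \int[nu]_x ((\sum_p c p * w p x) ^+ 2).
Proof.
move=> bw; rewrite (_ : (fun x : X => _) =
  (fun x : X => \sum_p \sum_q c p * c q * (w p x * w q x))).
  have bpq p q : bounded_measurable (fun x : X => c p * c q * (w p x * w q x)).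
    by apply: bounded_measurableZ; exact: bounded_measurableM.
  rewrite bRintegral_sum => [|p]; last exact: bounded_measurable_sum.
  apply: eq_bigr => p _; rewrite bRintegral_sum//; apply: eq_bigr => q _.
  by rewrite bRintegralZ//; exact: bounded_measurableM.
apply/funext => x; rewrite expr2 mulr_suml; apply: eq_bigr => p _.
by rewrite mulr_sumr; apply: eq_bigr => q _; ring.
Qed.

Lemma quad_energy nu v c : (forall p, smooth (v p)) -> (forall p, compact (supp (v p))) ->
  quad (energy nu v) c =
  \sum_l \int[nu]_x ((\sum_p c p * partial l (v p) x) ^+ 2).
Proof.
move=> vs vk; transitivity (\sum_l quad (gram nu (fun p => partial l (v p))) c).
  rewrite /quad /energy [RHS]exchange_big/=; apply: eq_bigr => p _.
  rewrite [RHS]exchange_big/=; apply: eq_bigr => q _; exact: mulr_sumr.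
apply: eq_bigr => l _; apply: quad_gram => p.
apply: smooth_bounded_measurable; first exact: smooth_partial.
exact: compact_partial_supp.
Qed.

(** A nonnegative function has zero integral exactly when it vanishes almost everywhere. This turns
    the convention for a null denominator in [rayleigh] into a condition on the Gram form. *)
Lemma ae0_Rintegral_sqr nu (f : X -> R) : bounded_measurable f ->
  negligible nu [set x | f x != 0] <-> \int[nu]_x (f x ^+ 2) = 0.
Proof.
move=> bf; have bf2 : bounded_measurable (fun x => f x ^+ 2).
  by under eq_fun do rewrite expr2; exact: bounded_measurableM.
have mf2 : measurable_fun setT (fun x => (f x ^+ 2)%:E).
  by apply/measurable_EFinP; exact: bf2.1.
have abs : (\int[nu]_x `|(f x ^+ 2)%:E|)%E = (\int[nu]_x (f x ^+ 2))%:E.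
  rewrite -RintegralEFin//; apply: eq_integral => x _.
  by rewrite gee0_abs// lee_fin sqr_ge0.
have e1 : (\int[nu]_x `|(f x ^+ 2)%:E| = 0)%E <-> \int[nu]_x (f x ^+ 2) = 0.
  by rewrite abs; split=> [[]|->].
apply: iff_trans e1; apply: iff_trans (iff_sym (ae_eq_integral_abs nu measurableT mf2)).
rewrite (_ : [set x | f x != 0] = ~` [set x | setT x -> (f x ^+ 2)%:E = (cst 0 x)]) //.
apply/seteqP; split=> x /=.
  by move=> /eqP fx /(_ I) [] /eqP; rewrite sqrf_eq0 => /eqP.
move=> h; apply: contrapT => /negP; rewrite negbK => /eqP fx.
by apply: h => _; rewrite fx expr0n.
Qed.

Lemma enorm_grad_sum v c x : (forall p, smooth (v p)) ->
  enorm (grad (fun y => \sum_p c p * v p y) x) ^+ 2 =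
  \sum_l (\sum_p c p * partial l (v p) x) ^+ 2.
Proof.
move=> vs; rewrite sqr_sqrtr; last by apply: sumr_ge0 => l _; exact: sqr_ge0.
by apply: eq_bigr => l _; rewrite mxE partial_sum.
Qed.

(** Here [nu] is [mass S] equipped with its measure structure, so [rayleigh] becomes a quotient of
    two quadratic forms in the coefficients. *)
Lemma rayleigh_quad n (S : functional R N n) nu v c :
  (forall A, nu A = mass S A) ->
  (forall p, smooth (v p)) -> (forall p, compact (supp (v p))) ->
  let f := fun y => \sum_p c p * v p y in
  (quad (gram nu v) c = 0 -> rayleigh S f = +oo%E) /\
  (quad (gram nu v) c != 0 ->
     rayleigh S f = (quad (energy nu v) c / quad (gram nu v) c)%:E).
Proof.
move=> nuS vs vk f.
have nuE : mass S = nu :> (set X -> \bar R) by apply/funext => A; rewrite nuS.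
have bv p : bounded_measurable (v p : X -> R) by exact: smooth_bounded_measurable.
have bf : bounded_measurable (f : X -> R).
  by apply: bounded_measurable_sum => p; exact: bounded_measurableZ.
have f2 : quad (gram nu v) c = \int[nu]_x (f x ^+ 2) by exact: quad_gram.
have neg := ae0_Rintegral_sqr nu f bf.
rewrite /rayleigh nuE; split => q0; first by rewrite asboolT//; apply/neg; rewrite -f2.
rewrite asboolF; last by move=> /neg h; move/eqP: q0; rewrite f2.
under eq_integral do rewrite enorm_grad_sum//.
under [X in (_ / X)%E]eq_integral do rewrite real_normK ?num_real//.
have bp l p : bounded_measurable (partial l (v p) : X -> R).
  by apply: smooth_bounded_measurable; [exact: smooth_partial|exact: compact_partial_supp].
have bs l : bounded_measurable (fun x : X => (\sum_p c p * partial l (v p) x) ^+ 2).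
  under eq_fun do rewrite expr2.
  by apply: bounded_measurableM; apply: bounded_measurable_sum => p; exact: bounded_measurableZ.
rewrite RintegralEFin; last exact: bounded_measurable_sum.
rewrite RintegralEFin; last by under eq_fun do rewrite expr2; exact: bounded_measurableM.
rewrite -f2 bRintegral_sum// -quad_energy// inver (negbTE q0).
by rewrite -EFinM.
Qed.

End Gram.

(** * Truncation and semicontinuity *)

Lemma cvgn_sum {R : realType} I (r : seq I) (f : I -> nat -> R) (l : I -> R) :
  (forall i, f i @ \oo --> l i) ->
  (fun m => \sum_(i <- r) f i m) @ \oo --> \sum_(i <- r) l i.
Proof.
move=> fl; elim: r => [|i r ih].
  by rewrite big_nil; under eq_fun do rewrite big_nil; exact: cvg_cst.
rewrite big_cons; under eq_fun do rewrite big_cons.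
exact: cvgD (fl i) ih.
Qed.

Section Truncation.
Context {R : realType} {N k : nat}.
Local Notation X := (@borel_space R N).
Variable b : 'I_k -> 'rV[R]_N -> R.
Hypothesis bs : forall p, smooth (b p).
Hypothesis bk : forall p, compact (supp (b p)).

Definition sqsum (x : 'rV[R]_N) : R := \sum_p b p x * b p x.

Definition trunc (m : nat) (p : 'I_k) (x : 'rV[R]_N) : R :=
  cutoff m.+1%:R sqsum x * b p x.

Lemma sqsum_smooth : smooth sqsum.
Proof. by apply: smooth_sum => p; exact: smoothM. Qed.

Lemma trunc_smooth m p : smooth (trunc m p).
Proof. by apply: smoothM => //; apply: smooth_cutoff; exact: sqsum_smooth. Qed.

(** Each square is at most [sqsum], hence so is the average of two squares, which dominates the
    product, also when p = q. *)
Lemma sqsum_ge p q x : `|b p x| * `|b q x| <= sqsum x.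
Proof.
have sq p' : b p' x ^+ 2 <= sqsum x.
  rewrite /sqsum (bigD1 p')//= -expr2 lerDl sumr_ge0// => r _.
  by rewrite -expr2 sqr_ge0.
have := sq p; have := sq q; rewrite -normrM ler_norml.
have := sqr_ge0 (b p x + b q x); have := sqr_ge0 (b p x - b q x).
by rewrite !expr2; lra.
Qed.

Lemma sqsum_ge0 x : 0 <= sqsum x.
Proof. by apply: sumr_ge0 => p _; rewrite -expr2 sqr_ge0. Qed.

Lemma sqsum_eq0 p x : sqsum x = 0 -> b p x = 0.
Proof.
move=> g0; have := sqsum_ge p p x; rewrite g0 -normrM normr_le0 mulf_eq0 orbb.
by move/eqP.
Qed.

Lemma trunc_supp m p : supp (trunc m p) `<=` supp (b p).
Proof. by apply: closureS => x /=; rewrite mulf_eq0 negb_or => /andP[]. Qed.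

Lemma trunc_compact m p : compact (supp (trunc m p)).
Proof.
by apply: (subclosed_compact _ (bk p)); [exact: closed_closure|exact: trunc_supp].
Qed.

(** Positivity persists on the closed support because the cutoff lives in a closed set where [sqsum]
    is at least 1 / (m + 1). *)
Lemma trunc_sqsum m p x : supp (trunc m p) x -> 0 < sqsum x.
Proof.
move=> sx; have h : 1 <= m.+1%:R * sqsum x.
  apply: (cutoff_closure m.+1%:R sqsum (smooth_cont _ sqsum_smooth)).
  by apply: closureS sx => y /=; rewrite mulf_eq0 negb_or => /andP[].
rewrite lt_def sqsum_ge0 andbT; apply: contraTneq h => ->.
by rewrite mulr0 -ltNge.
Qed.

Lemma near_sqsum x : sqsum x != 0 -> \forall m \near \oo, 1 <= m.+1%:R * sqsum x - 1.
Proof.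
move=> g0; have gp : 0 < sqsum x by rewrite lt_def g0 sqsum_ge0.
near=> m; rewrite lerBrDr -ler_pdivrMr//.
have : (1 + 1) / sqsum x <= m%:R by near: m; exact: nbhs_infty_ger.
by move/le_trans; apply; rewrite ler_nat.
Unshelve. all: by end_near.
Qed.

Lemma trunc_cvg p x : (fun m => trunc m p x) @ \oo --> b p x.
Proof.
have [g0|g0] := eqVneq (sqsum x) 0.
  rewrite (_ : (fun m => trunc m p x) = cst (b p x)); first exact: cvg_cst.
  by apply/funext => m; rewrite /trunc (sqsum_eq0 p x g0) mulr0.
apply: cvg_near_cst; apply: filterS (near_sqsum x g0) => m h.
by rewrite /trunc /cutoff step_ge1// mul1r.
Qed.

Lemma trunc_le m p x : `|trunc m p x| <= `|b p x|.
Proof.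
by rewrite normrM ler_piMl// ger0_norm ?step_ge0// step_le1.
Qed.

(** The factor m + 1 from differentiating the cutoff is grouped with the product b_p b_q, which
    compensates it by [sqsum_ge]. *)
Lemma partial_trunc l m p x : partial l (trunc m p) x =
  cutoff m.+1%:R sqsum x * partial l (b p) x +
  dstep (m.+1%:R * sqsum x - 1) *
    \sum_q 2 * (m.+1%:R * (b p x * b q x)) * partial l (b q) x.
Proof.
have ds := smooth_diff _ sqsum_smooth.
have db p' := smooth_diff _ (bs p').
have dcst (c : R) : forall y, differentiable (cst c : 'rV[R]_N -> R) y.
  by move=> y; exact: differentiable_cst.
have pg : partial l sqsum x = \sum_q 2 * b q x * partial l (b q) x.
  rewrite /sqsum /partial.
  rewrite (_ : (fun y => _) = \sum_q (b q \* b q)); last first.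
    by apply/funext => y; rewrite fct_sumE.
  rewrite derive_sum => [|q]; last by apply: derivableM; exact: diff_derivable.
  apply: eq_bigr => q _; rewrite deriveM; [|exact: diff_derivable..].
  by rewrite /GRing.scale/=; ring.
pose a : R := m.+1%:R.
have dc y : differentiable (cutoff a sqsum) y.
  by apply: smooth_diff; apply: smooth_cutoff; exact: sqsum_smooth.
have pc : partial l (cutoff a sqsum) x =
    dstep (a * sqsum x - 1) * (a * partial l sqsum x).
  have da y : differentiable ((cst a \* sqsum) \+ cst (-1)) y.
    by apply: differentiableD => //; exact: differentiableM.
  rewrite (_ : cutoff a sqsum = step \o ((cst a \* sqsum) \+ cst (-1)))//.
  rewrite (partial_comp l _ _ _ step_derive)//= partialD//; last first.
    by move=> y; exact: differentiableM.
  by rewrite partialM//= !partial_cst /= mulr0 !addr0.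
rewrite (_ : trunc m p = cutoff a sqsum \* b p)// partialM//= pc pg.
congr (_ + _); rewrite mulrCA; congr (_ * _).
rewrite !mulr_sumr; apply: eq_bigr => q _; ring.
Qed.

(* The limit gradient vanishes, rather than being the gradient of b p, where all
   the b q are zero; this can only decrease the energy. *)
Definition gradlim (l : 'I_N) (p : 'I_k) (x : 'rV[R]_N) : R :=
  \1_[set x | sqsum x != 0] x * partial l (b p) x.

Lemma partial_trunc_cvg l p x :
  (fun m => partial l (trunc m p) x) @ \oo --> gradlim l p x.
Proof.
rewrite /gradlim indicE; have [g0|g0] := eqVneq (sqsum x) 0.
  rewrite memNset/= ?g0 ?eqxx// mul0r.
  rewrite (_ : (fun m => _) = cst 0); first exact: cvg_cst.
  (* At a zero of [sqsum] the argument of the step is -1, where both [step] and [dstep] vanish. *)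
  apply/funext => m; rewrite partial_trunc /cutoff g0 mulr0 sub0r.
  by rewrite step_le0 ?dstep_le0 ?mul0r ?addr0// lerN10.
rewrite mem_set//= mul1r.
apply: cvg_near_cst; apply: filterS (near_sqsum x g0) => m h.
by rewrite partial_trunc /cutoff step_ge1// dstep_ge1// mul1r mul0r addr0.
Qed.

Lemma partial_trunc_bounded : exists B : R,
  forall l m p x, `|partial l (trunc m p) x| <= B.
Proof.
have [Bd Bd0 HBd] := @dstep_bounded R.
have /choice[B HB] : forall lp : 'I_N * 'I_k, exists B : R,
    forall x, `|partial lp.1 (b lp.2) x| <= B.
  move=> [l p]; apply: compact_supp_bounded; last exact: compact_partial_supp.
  by apply: smooth_cont; exact: smooth_partial.
pose C := \sum_lp `|B lp|.
have C0 : 0 <= C by exact: sumr_ge0.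
have HC l p x : `|partial l (b p) x| <= C.
  apply: le_trans (HB (l, p) x) _; apply: le_trans (ler_norm _) _.
  by rewrite /C (bigD1 (l, p))//= lerDl; exact: sumr_ge0.
(* Where [dstep] can be nonzero, (m + 1) [sqsum] is below 2. With the coefficient 2 of
   [partial_trunc] this gives 4, uniformly in [m]. *)
exists (C + Bd * \sum_(q < k) 4 * C) => l m p x.
rewrite partial_trunc; apply: le_trans (ler_normD _ _) _; apply: lerD.
  rewrite normrM; apply: le_trans _ (HC l p x).
  by rewrite ler_piMl// ger0_norm ?step_ge0// step_le1.
have S0 : 0 <= \sum_(q < k) 4 * C by apply: sumr_ge0 => q _; rewrite mulr_ge0.
have [h|h] := leP 1 (m.+1%:R * sqsum x - 1).
  by rewrite dstep_ge1// mul0r normr0 mulr_ge0.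
rewrite normrM ler_pM//; apply: le_trans (ler_norm_sum _ _ _) _.
apply: ler_sum => q _; rewrite normrM ler_pM// !normrM !normr_nat.
rewrite (_ : 4 = 2 * 2); last by ring.
rewrite ler_wpM2l//; apply: le_trans (_ : m.+1%:R * sqsum x <= 2).
  by rewrite ler_wpM2l// sqsum_ge.
by apply/ltW; lra.
Qed.

Variable mu : {finite_measure set X -> \bar R}.

Lemma sqsum_neq0_measurable : measurable ([set x | sqsum x != 0] : set X).
Proof.
apply: open_borel; apply: (@open_comp _ _ sqsum [set t | t != 0]); last exact: open_neq.
by move=> x _; exact: (smooth_cont _ sqsum_smooth).
Qed.

Lemma bounded_partial l p : bounded_measurable (partial l (b p) : X -> R).
Proof.
by apply: smooth_bounded_measurable; [exact: smooth_partial|exact: compact_partial_supp].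
Qed.

Lemma bounded_gradlim l p : bounded_measurable (gradlim l p : X -> R).
Proof.
apply: bounded_measurableM; last exact: bounded_partial.
exact: (bounded_measurable_indic _ sqsum_neq0_measurable).
Qed.

Lemma gram_trunc_cvg p q : (fun m => gram mu (trunc m) p q) @ \oo --> gram mu b p q.
Proof.
have [B HB] := compact_supp_bounded _ (smooth_cont _ (bs p)) (bk p).
have [C HC] := compact_supp_bounded _ (smooth_cont _ (bs q)) (bk q).
have bt m r : bounded_measurable (trunc m r : X -> R).
  by apply: smooth_bounded_measurable; [exact: trunc_smooth|exact: trunc_compact].
have bb r : bounded_measurable (b r : X -> R) by exact: smooth_bounded_measurable.
apply: (@bounded_cvg_Rintegral _ _ _ _ _ _ (B * C)).
- by move=> m; have [] := bounded_measurableM _ _ (bt m p) (bt m q).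
- by have [] := bounded_measurableM _ _ (bb p) (bb q).
- move=> m x; rewrite normrM ler_pM//.
    exact: le_trans (trunc_le _ _ _) (HB x).
  exact: le_trans (trunc_le _ _ _) (HC x).
- by move=> x; apply: cvgM; exact: trunc_cvg.
Qed.

Definition energylim (p q : 'I_k) : R := \sum_l gram mu (gradlim l) p q.

Lemma energy_trunc_cvg p q : (fun m => energy mu (trunc m) p q) @ \oo --> energylim p q.
Proof.
have [B HB] := partial_trunc_bounded.
rewrite /energylim /energy.
apply: (cvgn_sum _ _ (fun l m => gram mu (fun p => partial l (trunc m p)) p q)) => l.
have bt m r : bounded_measurable (partial l (trunc m r) : X -> R).
  apply: smooth_bounded_measurable; first by apply: smooth_partial; exact: trunc_smooth.
  by apply: compact_partial_supp; exact: trunc_compact.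
apply: (@bounded_cvg_Rintegral _ _ _ _ _ _ (B * B)).
- by move=> m; have [] := bounded_measurableM _ _ (bt m p) (bt m q).
- by have [] := bounded_measurableM _ _ (bounded_gradlim l p) (bounded_gradlim l q).
- by move=> m x; rewrite normrM ler_pM.
- by move=> x; apply: cvgM; exact: partial_trunc_cvg.
Qed.

Lemma quad_energylim_le c : quad energylim c <= quad (energy mu b) c.
Proof.
rewrite quad_energy// (_ : quad energylim c = \sum_l quad (gram mu (gradlim l)) c).
  apply: ler_sum => l _; rewrite quad_gram => [|p]; last exact: bounded_gradlim.
  apply: ble_Rintegral.
  - under eq_fun do rewrite expr2.
    by apply: bounded_measurableM; apply: bounded_measurable_sum => p;
      apply: bounded_measurableZ; exact: bounded_gradlim.
  - under eq_fun do rewrite expr2.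
    by apply: bounded_measurableM; apply: bounded_measurable_sum => p;
      apply: bounded_measurableZ; exact: bounded_partial.
  (* The indicator is common to all [p], so it factors out of the sum, and its square is at most
     1. *)
  move=> x; rewrite /gradlim; under eq_bigr do rewrite mulrCA.
  rewrite -mulr_sumr exprMn ler_piMl ?sqr_ge0// indicE.
rewrite /quad /energylim [RHS]exchange_big/=; apply: eq_bigr => p _.
by rewrite [RHS]exchange_big/=; apply: eq_bigr => q _; exact: mulr_sumr.
Qed.

End Truncation.

(** One form, within e / 2 of the supremum for [T], competes for every [T_ i]; weak convergence on
    it costs the other e / 2. *)
Lemma mass_lsc {R : realType} {N n : nat} (T_ : nat -> functional R N n)
    (T : functional R N n) :
  (forall i, form_linear (T_ i)) -> (forall i, finite_mass (T_ i)) ->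
  form_linear T -> finite_mass T -> weak_cvg T_ T ->
  forall U : set 'rV[R]_N, open U -> forall e : R, 0 < e ->
  \forall i \near \oo, fine (mass T U) - e <= fine (mass (T_ i) U).
Proof.
move=> Tl_ Tf_ Tl Tf TT U oU e e0.
have e2 : 0 < e / 2 by rewrite divr_gt0.
have fT : mass T U \is a fin_num by exact: mass_fin_num.
have := fT; rewrite (mass_openE _ _ oU) => /(ub_ereal_sup_adherent e2).
move=> [_ [phi aphi <-]]; rewrite -/(mass_open T U) -(mass_openE _ _ oU).
rewrite -(fineK fT) -EFinD lte_fin => hphi.
have [tphi _ _] := aphi.
have /cvgr_gt/(_ (T phi - e / 2)) := TT phi tphi.
have -> : (T phi - e / 2 < T phi) = true by rewrite gtrBl.
move=> /(_ isT); apply: filterS => i hi.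
have : ((T_ i phi)%:E <= mass (T_ i) U)%E by rewrite mass_openE//; exact: mass_open_ub.
rewrite -(fineK (mass_fin_num _ (Tl_ i) (Tf_ i) U)) lee_fin; lra.
Qed.

Lemma Cc_infty_sum {R : realType} {N k : nat} (A : set 'rV[R]_N) (c : 'I_k -> R)
    (v : 'I_k -> 'rV[R]_N -> R) :
  (forall p, Cc_infty A (v p)) -> Cc_infty A (fun x => \sum_p c p * v p x).
Proof.
move=> vC; elim: (index_enum _) => [|p r [ihs ihk ihA]].
  under eq_fun do rewrite big_nil.
  have s0 : supp (fun=> 0 : R) = set0 :> set 'rV[R]_N.
    rewrite /supp (_ : mkset _ = set0) ?closure0//.
    by apply/seteqP; split=> // x /=; rewrite eqxx.
  by split; [exact: smooth_cst|rewrite s0; exact: compact0|rewrite s0].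
under eq_fun do rewrite big_cons.
have [ps pk pA] := vC p.
have sub : supp (fun x => c p * v p x + \sum_(j <- r) c j * v j x) `<=`
    supp (v p) `|` supp (fun x => \sum_(j <- r) c j * v j x).
  rewrite /supp -closureU; apply: closureS => x /=.
  have [->|] := eqVneq (v p x) 0; last by left.
  by rewrite mulr0 add0r; right.
split; first by apply: smoothD => //; exact: smoothZ.
  apply: (subclosed_compact _ (compactU pk ihk)) => //; exact: closed_closure.
by apply: (subset_trans sub) => x [/pA|/ihA].
Qed.

(** * Upper semicontinuity of the eigenvalues *)

Section Semicontinuity.
Context {R : realType} {N n : nat}.
Variables (T_ : nat -> functional R N n) (T : functional R N n).
Hypothesis Tlin_ : forall i, form_linear (T_ i).
Hypothesis Tfin_ : forall i, finite_mass (T_ i).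
Hypothesis Tlin : form_linear T.
Hypothesis Tfin : finite_mass T.
Hypothesis T_weak : weak_cvg T_ T.
Hypothesis T_mass : (fun i => mass (T_ i) setT) @ \oo --> mass T setT.
Hypothesis T_set : forall e : R, 0 < e -> \forall i \near \oo,
  density_set (bdry (T_ i)) `<=` nbhd (density_set (bdry T)) e.

Local Notation X := (@borel_space R N).

Let mu_ i : {finite_measure set X -> \bar R} := mass_measure (T_ i) (Tlin_ i) (Tfin_ i).
Let mu : {finite_measure set X -> \bar R} := mass_measure T Tlin Tfin.

Let mass_weak_cvg (f : 'rV[R]_N -> R) (B : R) : continuous f ->
  (forall x, `|f x| <= B) ->
  (fun i => \int[mu_ i]_x f x) @ \oo --> \int[mu]_x f x.
Proof.
apply: Rintegral_weak_cvg; first exact: mass_lsc.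
apply: fine_cvg; rewrite fineK; first exact: T_mass.
exact: (mass_fin_num _ Tlin Tfin).
Qed.

Let gram_cvg k (v : 'I_k -> 'rV[R]_N -> R) p q :
  (forall p, smooth (v p)) -> (forall p, compact (supp (v p))) ->
  (fun i => gram (mu_ i) v p q) @ \oo --> gram mu v p q.
Proof.
move=> vs vk.
have [B HB] := compact_supp_bounded _ (smooth_cont _ (vs p)) (vk p).
have [C HC] := compact_supp_bounded _ (smooth_cont _ (vs q)) (vk q).
apply: (mass_weak_cvg _ (B * C)).
  by apply: smooth_cont; exact: smoothM.
by move=> x; rewrite normrM ler_pM.
Qed.

Let energy_cvg k (v : 'I_k -> 'rV[R]_N -> R) p q :
  (forall p, smooth (v p)) -> (forall p, compact (supp (v p))) ->
  (fun i => energy (mu_ i) v p q) @ \oo --> energy mu v p q.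
Proof.
move=> vs vk.
apply: (cvgn_sum _ _ (fun l i => gram (mu_ i) (fun p => partial l (v p)) p q)) => l.
apply: gram_cvg => r; first exact: smooth_partial.
exact: compact_partial_supp.
Qed.

(** The gap between [M] and [M'] pays for truncating a good space for [T] and for replacing [T] by
    [T_ i]. *)
Lemma lambda_hat_near k (M M' : R) : M < M' -> (lambda_hat k T < M%:E)%E ->
  \forall i \near \oo, (lambda_hat k (T_ i) <= M'%:E)%E.
Proof.
move=> MM' /ereal_inf_lt[_ [L [[b [bfree LE]] LC] <-]] LM.
have Lb (c : 'I_k -> R) : L (fun x => \sum_p c p * b p x).
  by rewrite LE; exists c.
have bL p : L (b p).
  rewrite LE; exists (fun q => (q == p)%:R); apply/funext => x.
  rewrite (bigD1 p)//= eqxx mul1r big1 ?addr0// => q /negPf ->.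
  by rewrite mul0r.
have bs p : smooth (b p) by have [] := LC _ (bL p).
have bk p : compact (supp (b p)) by have [] := LC _ (bL p).
have bd p : supp (b p) `<=` ~` density_set (bdry T) by have [] := LC _ (bL p).
(* A combination vanishing almost everywhere would have quotient +oo, so a quotient below [M] forces
   the Gram form to be positive. *)
have ray c p : c p != 0 -> 0 < quad (gram mu b) c /\
    quad (energy mu b) c <= M * quad (gram mu b) c.
  move=> cp; pose f x := \sum_p c p * b p x.
  have fL : (L `\ cst 0) f.
    split; first exact: Lb.
    move=> f0; move/eqP: cp; apply; apply: (bfree c) => x.
    by rewrite -[LHS]/(f x) f0.
  have rM : (rayleigh T f < M%:E)%E.
    by apply: le_lt_trans LM; apply: ereal_sup_ubound; exists f.
  have [r0 r1] := rayleigh_quad _ T mu b c (fun=> erefl) bs bk.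
  have [q0|q0] := eqVneq (quad (gram mu b) c) 0.
    by move: rM; rewrite (r0 q0).
  have qp : 0 < quad (gram mu b) c.
    rewrite lt_def q0/= quad_gram => [|r]; last exact: smooth_bounded_measurable.
    by apply: Rintegral_ge0 => x _; exact: sqr_ge0.
  split => //; move: rM; rewrite (r1 q0) lte_fin ltr_pdivrMr//; exact: ltW.
have ray0 c : quad (energylim b mu) c <= M * quad (gram mu b) c.
  apply: le_trans (quad_energylim_le b bs bk mu c) _.
  have [[p /ray[]//]|c0] := pselect (exists p, c p != 0).
  have {}c0 p : c p = 0 by apply: contrapT => /eqP cp; apply: c0; exists p.
  by rewrite /quad !big1 ?mulr0// => p _; rewrite big1// => q _; rewrite c0 !mul0r.
(* The tolerance [e] is shared: half for the truncation, with [m] fixed first, and half for the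
   limit in [i]. *)
have [e e0 He] := quad_ratio _ _ _ _ MM' (fun c p cp => (ray c p cp).1) ray0.
have e2 : 0 < e / 2 by rewrite divr_gt0.
have [m [gm em]] : exists m,
    (forall p q, `|gram mu (trunc b m) p q - gram mu b p q| <= e / 2) /\
    (forall p q, `|energy mu (trunc b m) p q - energylim b mu p q| <= e / 2).
  near \oo => m; exists m; split; near: m.
    apply: filter_forall => p; apply: filter_forall => q.
    exact: (cvgr_distC_le _ _ (gram_trunc_cvg b bs bk mu p q) _ e2).
  apply: filter_forall => p; apply: filter_forall => q.
  exact: (cvgr_distC_le _ _ (energy_trunc_cvg b bs bk mu p q) _ e2).
pose v := trunc b m.
have vs p : smooth (v p) by exact: trunc_smooth.
have vk p : compact (supp (v p)) by exact: trunc_compact.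
have vsep p : \forall i \near \oo, supp (v p) `<=` ~` density_set (bdry (T_ i)).
  have [r r0 Hr] : exists2 r : R, 0 < r &
      forall x, supp (v p) x -> ~ nbhd (density_set (bdry T)) r x.
    (* By continuity [sqsum] vanishes on the closure of [density_set (bdry T)], while it is positive
       on the support of the truncated function. *)
    apply: nbhd_separated; first exact: vk.
    move=> x /(trunc_sqsum b bs) gx dx; move: gx.
    suff -> : sqsum b x = 0 by rewrite ltxx.
    have : closed [set y | sqsum b y = 0].
      apply: (@closed_comp _ _ (sqsum b) [set t | t = 0]); last exact: closed_eq.
      by move=> y _; exact: (smooth_cont _ (sqsum_smooth b bs)).
    apply; apply: closureS dx => y dy /=; rewrite /sqsum big1// => q _.
    by rewrite (notin_supp (b q) y) ?mul0r// => /bd.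
  by apply: filterS (T_set _ r0) => i Hi x /Hr nx /Hi.
near=> i.
have gi p q : `|gram (mu_ i) v p q - gram mu v p q| <= e / 2.
  move: p q; near: i; apply: filter_forall => p; apply: filter_forall => q.
  exact: (cvgr_distC_le _ _ (gram_cvg _ v p q vs vk) _ e2).
have ei p q : `|energy (mu_ i) v p q - energy mu v p q| <= e / 2.
  move: p q; near: i; apply: filter_forall => p; apply: filter_forall => q.
  exact: (cvgr_distC_le _ _ (energy_cvg _ v p q vs vk) _ e2).
have si p : supp (v p) `<=` ~` density_set (bdry (T_ i)).
  by move: p; near: i; apply: filter_forall => p; exact: vsep.
have {}He := He (gram (mu_ i) v) (energy (mu_ i) v) _ _.
have {}He c p : c p != 0 -> 0 < quad (gram (mu_ i) v) c /\
    quad (energy (mu_ i) v) c <= M' * quad (gram (mu_ i) v) c.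
  apply: He => p' q'.
    by rewrite [e]splitr; apply: le_trans (ler_distD (gram mu v p' q') _ _) _;
      exact: lerD.
  by rewrite [e]splitr; apply: le_trans (ler_distD (energy mu v p' q') _ _) _;
    exact: lerD.
pose L' := [set f | exists c : 'I_k -> R, f = fun x => \sum_p c p * v p x].
apply: (@le_trans _ _ (ereal_sup [set rayleigh (T_ i) f | f in L' `\ cst 0])).
  apply: ereal_inf_lbound; exists L'; last reflexivity.
  split.
    (* Truncation keeps the dimension: a linear relation would be a nonzero [c] at which the
       positive Gram form vanishes. *)
    exists v; split => // c c0 p; apply: contrapT => /eqP cp.
    have [+ _] := He c p cp; rewrite quad_gram => [|r];
      last exact: smooth_bounded_measurable.
    under eq_Rintegral do rewrite c0 expr0n.
    by rewrite Rintegral_cst// mul0r ltxx.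
  by move=> _ [c ->]; apply: Cc_infty_sum.
apply: ge_ereal_sup => _ [f [[c ->] fn0] <-].
have [p cp] : exists p, c p != 0.
  apply: contrapT => h; apply: fn0; apply/funext => x /=.
  rewrite big1// => p _; suff -> : c p = 0 by rewrite mul0r.
  by apply: contrapT => /eqP cp; apply: h; exists p.
have [gp le] := He c p cp.
have [_ ->] := rayleigh_quad _ (T_ i) (mu_ i) v c (fun=> erefl) vs vk;
  last by rewrite gt_eqF.
by rewrite lee_fin ler_pdivrMr.
Unshelve. all: by end_near.
Qed.

Lemma lambda_hat_usc k : (limn_esup (fun i => lambda_hat k (T_ i)) <= lambda_hat k T)%E.
Proof.
have H (M M' : R) : M < M' -> (lambda_hat k T < M%:E)%E ->
    (limn_esup (fun i => lambda_hat k (T_ i)) <= M'%:E)%E.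
  move=> MM' TM; rewrite /limn_esup /limf_esup.
  (* The upper limit is an infimum over sets in the filter, so one such set suffices. *)
  have [A [B C]] : exists A : set nat, (\oo : set_system nat) A /\
      forall i, A i -> (lambda_hat k (T_ i) <= M'%:E)%E.
    by exists [set i | (lambda_hat k (T_ i) <= M'%:E)%E]; split => //;
      exact: lambda_hat_near TM.
  apply: (@le_trans _ _ (ereal_sup [set lambda_hat k (T_ i) | i in A])).
    by apply: ereal_inf_lbound; exists A.
  by apply: ge_ereal_sup => _ [i /C ? <-].
(* For a finite value take M = x + r/2 and M' = x + r. The value -oo does occur for [k = 0], as a
   supremum over no functions; then every real bounds the upper limit. *)
case E : (lambda_hat k T) H => [x||] H.
- apply/lee_addgt0Pr => r r0; rewrite -EFinD; apply: (H (x + r / 2)).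
    by rewrite ltrD2l ltr_pdivrMr// ltr_pMr// ltr1n.
  by rewrite lte_fin ltrDl divr_gt0.
- exact: leey.
- move: H; case: (limn_esup _) => [y||] H //.
  + have : (y%:E <= (y - 1)%:E)%E.
      by apply: (H (y - 2)); [rewrite ltrD2l ltrN2 ltr1n|exact: ltNyr].
    by rewrite lee_fin leNgt gtrBl ltr01.
  + by have := H 0 1 ltr01 (ltNyr _).
Qed.

End Semicontinuity.

Theorem theorem4 (R : realType) (N n : nat) (n_gt0 : (0 < n)%N)
    (n_le_N : (n <= N)%N)
    (T_ : nat -> functional R N n) (T : functional R N n)
    (T_normal : forall i, normal_current (T_ i)) (lim_normal : normal_current T)
    (T_rect : forall i, integer_rectifiable (T_ i))
    (lim_rect : integer_rectifiable T)
    (T_supp : forall i, compact (measure_supp (mass (T_ i))) /\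
                        compact (measure_supp (mass (bdry (T_ i)))))
    (lim_supp : compact (measure_supp (mass T)) /\
               compact (measure_supp (mass (bdry T))))
    (T_weak : weak_cvg T_ T)
    (T_mass : (fun i => mass (T_ i) setT) @ \oo --> mass T setT)
    (T_set : forall e : R, 0 < e -> \forall i \near \oo,
       density_set (bdry (T_ i)) `<=` nbhd (density_set (bdry T)) e)
    (k : nat) (k_gt0 : (0 < k)%N) :
  (limn_esup (fun i => lambda_hat k (T_ i)) <= lambda_hat k T)%E.
Proof.
have [[Tlin _] Tfin _] := lim_normal.
apply: lambda_hat_usc => // i; have [[Tlin_ _] Tfin_ _] := T_normal i.
- exact: Tlin_.
- exact: Tfin_.
Qed.
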